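(* (Malus-Dupin theorem) Let $N\ge 1$ and let an optical system consist of smooth surfaces $S_1,\dots,S_N$ in $\mathcal E$, each of them either reflecting or refracting. Let $L_0:\mathcal F\to\mathcal L$ be a two-parameters family of light rays entering this optical system, each ray of which bears at least one regular point, and let $L_j:\mathcal F\to\mathcal L$ ($1\le j\le N$) be the successive families of rays obtained from it by reflection on, or refraction across, $S_1,\dots,S_N$. If the entering family $L_0$ is rectangular, then the family of rays remains rectangular in each homogeneous and isotropic transparent medium in which it propagates, i.e. for every $j\in\{1,\dots,N\}$ the family $L_j$ is a rectangular two-parameters family of rays.
   Context: $\mathcal E$ is a three-dimensional affine Euclidean space and $\mathcal L$ is the set of all oriented straight lines in $\mathcal E$. It is a smooth $4$-dimensional manifold: after choosing an origin $O\in\mathcal E$, a line $L$ with unit directing vector $u$ is identified with the pair $(u,q)$, where $\|u\|=1$ and $q\perp u$ is the vector from $O$ to the orthogonal projection of $O$ on $L$. This identifies $\mathcal L$ with the tangent bundle of the unit sphere, and the smooth structure does not depend on $O$. Light rays are represented by the full oriented lines that bear them. A two-parameters family of rays is an immersed (not necessarily embedded) $2$-dimensional submanifold of $\mathcal L$, given here by a smooth $2$-manifold $\mathcal F$ and an immersion $\mathcal F\to\mathcal L$. Neighbourhoods in the family are taken in the manifold topology of $\mathcal F$, and an element of $\mathcal F$ is also called a ray (the corresponding oriented line). Regular point: a point $m_0$ of a ray $L_0$ of a two-parameters family $\mathcal F$ is regular if for any smooth surface $S\subset\mathcal E$ containing $m_0$ and transverse at $m_0$ to the ray, there exist an open neighbourhood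 $U$ of the ray in $\mathcal F$ and an open neighbourhood $V$ of $m_0$ in $S$ such that each ray $L\in U$ meets $V$ at a unique point $m$ and the map $L\mapsto m$ is a diffeomorphism of $U$ onto $V$. Rectangular: a two-parameters family $\mathcal F$ is rectangular if for each ray $L\in\mathcal F$ and each regular point $m$ of $L$ there exists a smooth surface containing $m$ which is orthogonally crossed by $L$ and by all the rays in a neighbourhood of $L$ in $\mathcal F$ (that is, each of these rays meets the surface and is perpendicular to its tangent plane at the meeting point). Laws of reflection and refraction: let a ray with unit directing vector $u$ hit a smooth surface $S$ at a point $P$, transversally, and let $n$ be a unit vector orthogonal to $S$ at $P$. If $S$ is reflecting, the reflected ray is the oriented line through $P$ with unit directing vector $u'=u-2(u\cdot n)n$. If $S$ is refracting and separates the medium in which the ray arrives, with refractive index $\nu>0$, from another homogeneous isotropic medium of refractive index $\nu'>0$, $\nu'\ne\nu$, the refracted ray is the oriented line through $P$ with unit directing vector $u'$ such that $\nu'\bigl(u'-(u'\cdot n)n\bigr)=\nu\bigl(u-(u\cdot n)n\bigr)$ and $u'\cdot n$ has the same sign as $u\cdot n$; it is assumed to exist and to be transverse to $S$ at $P$. Successive families: for $j=1,\dots,N$ there is a smooth map $P_j:\mathcal F\to S_j$ such that, for every $k\in\mathcal F$, $P_j(k)$ is the point at which the ray $L_{j-1}(k)$ hits $S_j$; the incident ray $L_{j-1}(k)$ is transverse to $S_j$ at $P_j(k)$; and $L_j(k)$ is the reflected ray (if $S_j$ is reflecting) or the refracted ray (if $S_j$ is refracting) corresponding to $L_{j-1}(k)$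 at $P_j(k)$. All the media between the surfaces are homogeneous and isotropic, each with a constant positive refractive index. *)

(* Defs.v *)
From HB Require Import structures.
From mathcomp Require Import all_boot all_order all_algebra.
From mathcomp Require Import all_classical all_reals all_analysis.

Set Implicit Arguments.
Unset Strict Implicit.
Unset Printing Implicit Defensive.

Import Order.TTheory GRing.Theory Num.Theory.
Import numFieldNormedType.Exports.

Local Open Scope classical_set_scope.
Local Open Scope ring_scope.

Section Smooth.
Context {R : realType} {V W : normedModType R}.

(* [class_C k D f] is meant for [D] open and [V] finite-dimensional.  There the
   derivative of [f] is of class C^k iff all the maps ['D_v f] are. *)
Fixpoint class_C (k : nat) (D : set V) (f : V -> W) : Prop :=
  match k with
  | 0 => forall x, D x -> {for x, continuous f}
  | k'.+1 => (forall x, D x -> differentiable f x) /\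
             forall v : V, class_C k' D (fun x => 'D_v f x)
  end.

Definition smooth_on (D : set V) (f : V -> W) : Prop :=
  forall k, class_C k D f.

Definition smooth_at (f : V -> W) (x : V) : Prop :=
  exists D : set V, [/\ open D, D x & smooth_on D f].

End Smooth.

(* A homeomorphism from an open subset of [M] onto an open subset of R^n.
   [chart_map] and [chart_inv] are total functions whose values outside
   [chart_dom] and its image carry no meaning. *)
Record chart (R : realType) (M : topologicalType) (n : nat) := Chart {
  chart_dom : set M;
  chart_map : M -> 'rV[R]_n;
  chart_inv : 'rV[R]_n -> M;
  chart_dom_open : open chart_dom;
  chart_img_open : open (chart_map @` chart_dom);
  chart_mapK : forall x, chart_dom x -> chart_inv (chart_map x) = x;
  chart_map_continuous : {within chart_dom, continuous chart_map};
  chart_inv_continuous :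
    {within chart_map @` chart_dom, continuous chart_inv}
}.

Record smooth_manifold (R : realType) (n : nat) := SmoothManifold {
  manifold_space :> topologicalType;
  atlas : set (chart R manifold_space n);
  manifold_hausdorff : hausdorff_space manifold_space;
  manifold_second_countable : @second_countable manifold_space;
  atlas_cover : forall x, exists2 c, atlas c & chart_dom c x;
  atlas_compatible : forall c c' x, atlas c -> atlas c' ->
    chart_dom c x -> chart_dom c' x ->
    smooth_at (chart_map c' \o chart_inv c) (chart_map c x)
}.

Section MapsOnManifolds.
Context {R : realType} {n : nat} (M : smooth_manifold R n).
Context {W : normedModType R}.

Definition smooth_map_at (f : M -> W) (x : M) : Prop :=
  forall c, atlas c -> chart_dom c x ->
    smooth_at (f \o chart_inv c) (chart_map c x).

Definition immersion (f : M -> W) : Prop :=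
  (forall x, smooth_map_at f x) /\
  forall x c, atlas c -> chart_dom c x ->
    injective ('d (f \o chart_inv c) (chart_map c x)).

End MapsOnManifolds.

(* The Euclidean space with an origin and an orthonormal frame chosen; points
   and vectors share this type.  The norm of ['rV[R]_3] in the library is the
   sup norm: it has the right topology, but lengths must be taken with
   [enorm]. *)
Notation E3 R := ('rV[R]_3).

Section EuclideanSpace.
Context {R : realType}.
Implicit Types (u v : E3 R) (p : E3 R) (S : set (E3 R)).

Definition dot u v : R := \sum_i u 0 i * v 0 i.

Definition enorm u : R := Num.sqrt (dot u u).

Definition rel_open S (A : set (E3 R)) : Prop :=
  exists2 W : set (E3 R), open W & A = S `&` W.

(* The condition on [D'] says that [phi] is a homeomorphism from [D] onto a
   relatively open subset of [S]. *)
Definition local_parametrization S (phi : 'rV[R]_2 -> E3 R)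
    (D : set 'rV[R]_2) : Prop :=
  [/\ open D,
      smooth_on D phi,
      (forall x, D x -> injective ('d phi x)),
      (forall x y, D x -> D y -> phi x = phi y -> x = y) &
      forall D' : set 'rV[R]_2, open D' -> D' `<=` D ->
        rel_open S (phi @` D')].

Definition smooth_surface S : Prop :=
  forall p, S p -> exists phi D,
    local_parametrization S phi D /\ (phi @` D) p.

(* Velocities at [p] of the smooth curves drawn on [S]. *)
Definition tangent S p v : Prop :=
  exists gamma : R^o -> E3 R,
    [/\ smooth_at gamma 0,
        (\forall t \near (0 : R^o), S (gamma t)),
        gamma 0 = p &
        'D_1 gamma 0 = v].

Definition orthogonal_to S p u : Prop :=
  forall v, tangent S p v -> dot u v = 0.

Definition unit_normal S p u : Prop := enorm u = 1 /\ orthogonal_to S p u.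

End EuclideanSpace.

Section SurfacesAndManifolds.
Context {R : realType} (M : smooth_manifold R 2).
Implicit Types (S : set (E3 R)).

(* Smooth maps from a relatively open subset [B] of the surface [S] to [M]. *)
Definition smooth_from_surface S (B : set (E3 R)) (g : E3 R -> M) :
    Prop :=
  {within B, continuous g} /\
  forall phi D x c, local_parametrization S phi D -> D x -> B (phi x) ->
    atlas c -> chart_dom c (g (phi x)) ->
    smooth_at (chart_map c \o g \o phi) x.

(* Surfaces being embedded, smoothness of [f] as a map into [S] is smoothness
   as a map into the ambient space. *)
Definition diffeomorphism (A : set M) S (B : set (E3 R))
    (f : M -> E3 R) : Prop :=
  exists g : E3 R -> M,
    [/\ (forall x, A x -> B (f x) /\ g (f x) = x),
        (forall p, B p -> A (g p) /\ f (g p) = p),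
        (forall x, A x -> smooth_map_at f x) &
        smooth_from_surface S B g].

End SurfacesAndManifolds.

(* [foot] is the orthogonal projection of the origin on the line. *)
Record oriented_line (R : realType) := OrientedLine {
  dir : E3 R;
  foot : E3 R;
  dir_unit : enorm dir = 1;
  foot_orth : dot foot dir = 0
}.

Section Rays.
Context {R : realType}.
Implicit Types (l : oriented_line R) (S : set (E3 R)) (p n : E3 R).

Definition on_line l p : Prop := exists t : R, p = foot l + t *: dir l.

(* The embedding of the manifold of oriented lines, seen as the tangent bundle
   of the unit sphere, in R^3 x R^3. *)
Definition line_coord l : E3 R * E3 R := (dir l, foot l).

Definition transverse S p l : Prop := ~ tangent S p (dir l).

Definition reflected S p l l' : Prop :=
  on_line l' p /\
  exists2 n, unit_normal S p n &
    dir l' = dir l - (2 * dot (dir l) n) *: n.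

Definition refracted (nu nu' : R) S p l l' : Prop :=
  [/\ on_line l' p,
      transverse S p l' &
      exists n, [/\ unit_normal S p n,
        nu' *: (dir l' - dot (dir l') n *: n) =
          nu *: (dir l - dot (dir l) n *: n) &
        Num.sg (dot (dir l') n) = Num.sg (dot (dir l) n)]].

End Rays.

Section Families.
Context {R : realType} (F : smooth_manifold R 2).
Implicit Types (L : F -> oriented_line R) (S : set (E3 R)) (k : F).

Definition two_parameter_family L : Prop :=
  immersion (@line_coord R \o L).

Definition regular_point L k0 (m0 : E3 R) : Prop :=
  on_line (L k0) m0 /\
  forall S, smooth_surface S -> S m0 -> transverse S m0 (L k0) ->
    exists (U : set F) (B : set (E3 R)) (f : F -> E3 R),
      [/\ open U /\ U k0,
          rel_open S B /\ B m0,
          (forall k, U k -> forall p, (B p /\ on_line (L k) p) <-> p = f k) &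
          diffeomorphism U S B f].

Definition orthogonally_crosses S (l : oriented_line R) : Prop :=
  (exists p, S p /\ on_line l p) /\
  forall p, S p -> on_line l p -> orthogonal_to S p (dir l).

Definition rectangular L : Prop :=
  forall k0 m, regular_point L k0 m ->
    exists S, [/\ smooth_surface S, S m &
      exists U : set F, [/\ open U, U k0 &
        forall k, U k -> orthogonally_crosses S (L k)]].

End Families.

Inductive surface_kind := Reflecting | Refracting.

Section OpticalSystems.
Context {R : realType}.

(* [nu j] is the index of the medium in which the rays travel between [S j]
   and [S j.+1]; a reflected ray stays in the medium of the incident one. *)
Definition optical_system (N : nat) (S : nat -> set (E3 R))
    (kind : nat -> surface_kind) (nu : nat -> R) : Prop :=
  (forall j, (j <= N)%N -> 0 < nu j) /\
  forall j, (1 <= j <= N)%N ->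
    smooth_surface (S j) /\
    match kind j with
    | Reflecting => nu j = nu j.-1
    | Refracting => nu j <> nu j.-1
    end.

Definition emerging_family (F : smooth_manifold R 2) (S : set (E3 R))
    (kind : surface_kind) (nu nu' : R) (P : F -> E3 R)
    (L L' : F -> oriented_line R) : Prop :=
  (forall k, smooth_map_at P k) /\
  forall k, [/\ S (P k),
    on_line (L k) (P k),
    transverse S (P k) (L k) &
    match kind with
    | Reflecting => reflected S (P k) (L k) (L' k)
    | Refracting => refracted nu nu' S (P k) (L k) (L' k)
    end].

End OpticalSystems.

(* Main.v *)
Require Import Defs.
From mathcomp Require Import all_boot all_order all_algebra.
From mathcomp Require Import all_classical all_reals all_analysis.
From mathcomp Require Import ring lra.

Set Implicit Arguments.
Unset Strict Implicit.
Unset Printing Implicit Defensive.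

Import Order.TTheory GRing.Theory Num.Theory.
Import numFieldNormedType.Exports.

Local Open Scope classical_set_scope.
Local Open Scope ring_scope.

(** A family of rays is treated through a possibly singular wavefront: a smooth
    map [Q] that picks on each ray a point [Q y] in such a way that the velocities
    of [Q] are orthogonal to the ray ([normal_section]). Everything is done in one
    chart of the family, where [u y] is the direction of the ray.

    A rectangular family with regular points has such a map: the surface that
    crosses the rays orthogonally is transverse to them, so that regularity makes
    the crossing point a smooth function of the ray
    ([rectangular_normal_section]).

    A deflection transports it. Let [P y] be the point where the ray hits the
    surface, [N y] a normal vector there and [u'] the new direction. The laws of
    reflection and refraction both say that [nu' u' - nu u] is a multiple of [N],
    hence vanishes on the velocities of [P]. If [Q'] is the point of the deflected
    ray such that the optical length [nu (P - Q).u + nu' (Q' - P).u'] is zero,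
    then differentiating this relation shows that the velocities of [Q'] are
    orthogonal to [u'] ([normal_section_deflected]). The deflected family is
    still immersed, because an incident ray cannot move to first order while the
    deflected one is at rest ([deflected_family]).

    Conversely, let [m] be a regular point of a ray of a family that has a map
    [Q]. Adding a constant multiple of [u] to [Q] gives another such map [W] which
    passes through [m]. Regularity, tested on a coordinate plane, forces [W] to be
    an immersion at [m] ([regular_section_immersive]); so [W] parametrizes a
    surface near [m], orthogonal to the rays at the points [W y]. Regularity,
    tested on this very surface, shows that the rays do not meet it elsewhere
    ([normal_section_rectangular]).

    Two technical points need work. The deflected directions depend smoothly on
    the ray because the normal vector can be chosen smoothly along [P]
    ([smooth_normal_along]); this goes through the parameter of [P y] in a
    parametrization of the surface, whose smoothness follows by bootstrapping
    from a formula for its derivative. And an immersion has a lower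
    Lipschitz bound near each point ([immersion_bilipschitz]), which makes it a
    parametrization of its image. *)

(** * Derivatives of vector-valued functions *)

Section RowValued.
Context {R : realType} {V : normedModType R} {n : nat}.
Implicit Types (f : V -> 'rV[R]_n) (x v : V).

Lemma row_sum_coord (w : 'rV[R]_n) : w = \sum_i w 0 i *: delta_mx 0 i.
Proof. by rewrite {1}[w]matrix_sum_delta big_ord1. Qed.

Lemma differentiable_rowP f x :
  differentiable f x <-> forall i, differentiable (fun y => f y 0 i : R) x.
Proof.
split=> [df i|df].
  by apply: (differentiable_comp df (g := fun N : 'rV[R]_n => N 0 i : R));
    exact: differentiable_coord.
rewrite (_ : f = \sum_i (fun y => f y 0 i *: delta_mx 0 i)).
  by apply: differentiable_sum => i; exact: differentiableZl.
by apply/funext => y; rewrite fct_sumE -row_sum_coord.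
Qed.

Lemma derive_row f x v i : differentiable f x ->
  ('D_v f x) 0 i = 'D_v (fun y => f y 0 i) x.
Proof. by move=> df; rewrite derive_mx ?mxE//; exact: diff_derivable. Qed.

Lemma continuous_rowP f x :
  {for x, continuous f} <-> forall i, {for x, continuous (fun y => f y 0 i : R)}.
Proof.
split=> [cf i|cf].
  by apply: (continuous_comp cf (g := fun N : 'rV[R]_n => N 0 i : R));
    exact: coord_continuous.
apply/cvgrPdist_le => /= e e0; near=> y.
rewrite [leLHS]/Num.Def.normr/= mx_normrE (bigmax_le _ (ltW e0))//= => -[i j] _.
rewrite !mxE /= ord1; move: j; near: y; apply: filter_forall => j.
by have /cvgrPdist_le := cf j; apply.
Unshelve. all: by end_near. Qed.

End RowValued.

(** * Functions of class C^k *)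

Lemma scalerE (R : realType) (a b : R) : a *: (b : R^o) = a * b.
Proof. by []. Qed.

Section ClassC.
Context {R : realType} {V : normedModType R}.
Implicit Types (k : nat) (D : set V).

Lemma near_open D (P : V -> Prop) x : open D -> D x -> (forall y, D y -> P y) ->
  \forall y \near x, P y.
Proof. by move=> oD Dx DP; apply: filterS DP _; apply: open_nbhs_nbhs. Qed.

Lemma differentiable_littleo (W : normedModType R) (e : V -> W) x :
  (forall eps : R, 0 < eps -> \forall y \near x, `|e y| <= eps * `|y - x|) ->
  differentiable e x.
Proof.
move=> eo.
have ex0 : e x = 0.
  by have := nbhs_singleton (eo 1 ltr01); rewrite subrr normr0 mulr0 normr_le0 => /eqP.
have dE : e \o shift x = cst (e x) + (\0 : {linear V -> W}) +o_ 0 id.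
  apply/eqaddoP => eps eps0.
  rewrite near_simpl; have /= := eo _ eps0; rewrite (near_shift 0) /= => {}eo.
  near=> y; rewrite /= !fctE /= ex0 !addr0 subr0.
  suff : `|e (y + (x - 0))| <= eps * `|y + (x - 0) - x| by rewrite subr0 addrK.
  by near: y.
have d0 := @diff_unique _ _ _ _ (\0 : {linear V -> W}) x (fun=> cvg_cst _) dE.
by apply/diff_locallyP; rewrite d0; split => //; exact: (fun=> cvg_cst _).
Unshelve. all: by end_near. Qed.

Lemma differentiable_near (W : normedModType R) (f g : V -> W) x :
  (\forall y \near x, f y = g y) -> differentiable f x -> differentiable g x.
Proof.
move=> fg df; rewrite (_ : g = f + (g - f)); last by rewrite addrC subrK.
apply: differentiableD => //; apply: differentiable_littleo => eps eps0.
by near=> y; rewrite !fctE (near fg y) // subrr normr0 mulr_ge0 // ltW.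
Unshelve. all: by end_near. Qed.

Lemma class_C_eq (W : normedModType R) k D (f g : V -> W) :
  open D -> (forall x, D x -> f x = g x) -> class_C k D f -> class_C k D g.
Proof.
elim: k f g => [|k IH] f g oD fg /= => [cf x Dx|[df Cf]].
  have := cf x Dx; rewrite /prop_for /continuous_at -(fg x Dx).
  by apply: cvg_trans; apply: near_eq_cvg; apply: (near_open oD Dx) => y /fg.
split=> [x Dx|v].
  by apply: differentiable_near (df x Dx); apply: (near_open oD Dx).
apply: IH (Cf v) => // x Dx; apply: near_eq_derive.
exact: (near_open oD Dx).
Qed.

Lemma class_C_sub (W : normedModType R) k D D' (f : V -> W) :
  D' `<=` D -> class_C k D f -> class_C k D' f.
Proof.
elim: k f => [|k IH] f sD /= => [cf x /sD /cf//|[df Cf]].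
by split=> [x /sD /df//|v]; exact: IH.
Qed.

Lemma class_CW (W : normedModType R) k D (f : V -> W) :
  class_C k.+1 D f -> class_C k D f.
Proof.
elim: k f => [|k IH] f [df Cf]; last by split=> // v; exact/IH/Cf.
by move=> x Dx; exact/differentiable_continuous/df.
Qed.

Lemma class_C_cst (W : normedModType R) k D (w : W) : class_C k D (cst w).
Proof.
elim: k w => [w x _|k IH w]; first exact: cvg_cst.
split=> [x _|v]; first exact: differentiable_cst.
by rewrite (_ : (fun x => _) = cst 0) //; apply/funext => x; rewrite derive_cst.
Qed.

Lemma class_C_linear (W : normedModType R) k D (T : {linear V -> W}) :
  continuous T -> class_C k D T.
Proof.
move=> cT; case: k => [x _|k]; first exact: cT.
split=> [x _|v]; first exact: linear_differentiable.
rewrite (_ : (fun x => _) = cst (T v)); first exact: class_C_cst.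
apply/funext => x; rewrite deriveE; last exact: linear_differentiable.
by rewrite diff_lin.
Qed.

Lemma class_C_id k D : class_C k D (@idfun V).
Proof. by apply: (@class_C_linear V k D idfun) => x; exact: cvg_id. Qed.

Lemma class_C_linear_comp (W W' : normedModType R) k D (T : {linear W -> W'})
    (f : V -> W) : open D -> continuous T ->
  class_C k D f -> class_C k D (T \o f).
Proof.
move=> oD cT; elim: k f => [|k IH] f /= => [cf x Dx|[df Cf]].
  by apply: (continuous_comp (cf x Dx)); exact: cT.
have dT y : differentiable T y by exact: linear_differentiable.
split=> [x Dx|v]; first exact: differentiable_comp (df x Dx) (dT _).
apply: class_C_eq (IH _ (Cf v)) => // x Dx /=.
have dfx := df x Dx.
rewrite [RHS]deriveE; last exact: differentiable_comp dfx (dT _).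
by rewrite diff_comp //= diff_lin // deriveE.
Qed.

Lemma class_C_pair (W W' : normedModType R) k D (f : V -> W) (g : V -> W') :
  open D -> class_C k D f -> class_C k D g ->
  class_C k D (fun x => (f x, g x)).
Proof.
move=> oD; elim: k f g => [|k IH] f g /= => [cf cg x Dx|[df Cf] [dg Cg]].
  by apply: cvg_pair; [exact: cf|exact: cg].
split=> [x Dx|v]; first by apply: differentiable_pair; [exact: df|exact: dg].
apply: class_C_eq (IH _ _ (Cf v) (Cg v)) => // x Dx /=.
have dfx := df x Dx; have dgx := dg x Dx.
rewrite [RHS]deriveE; last exact: differentiable_pair.
by rewrite diff_pair // !deriveE.
Qed.

Lemma class_C_rowP n k D (f : V -> 'rV[R]_n) : open D ->
  class_C k D f <-> forall i, class_C k D (fun x => f x 0 i : R).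
Proof.
move=> oD; elim: k f => [|k IH] f /=.
  split=> [cf i x Dx|cf x Dx]; first by have /continuous_rowP := cf x Dx; apply.
  by apply/continuous_rowP => i; exact: cf.
split=> [[df Cf] i|Cf].
  split=> [x Dx|v]; first by have /differentiable_rowP := df x Dx; apply.
  have /IH/(_ i) := Cf v; apply: class_C_eq => // x Dx.
  by rewrite derive_row //; exact: df.
have df x : D x -> differentiable f x.
  by move=> Dx; apply/differentiable_rowP => i; have [+ _] := Cf i; apply.
split=> // v; apply/IH => i; have [_ /(_ v)] := Cf i.
by apply: class_C_eq => // x Dx; rewrite derive_row //; exact: df.
Qed.

Lemma class_CD (W : normedModType R) k D (f g : V -> W) : open D ->
  class_C k D f -> class_C k D g -> class_C k D (f \+ g).
Proof.
move=> oD; elim: k f g => [|k IH] f g /= => [cf cg x Dx|[df Cf] [dg Cg]].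
  by apply: cvgD; [exact: cf|exact: cg].
split=> [x Dx|v]; first by apply: differentiableD; [exact: df|exact: dg].
apply: class_C_eq (IH _ _ (Cf v) (Cg v)) => // x Dx /=.
by rewrite [RHS]deriveD //; apply: diff_derivable; [exact: df|exact: dg].
Qed.

Lemma class_CN (W : normedModType R) k D (f : V -> W) : open D ->
  class_C k D f -> class_C k D (fun x => - f x).
Proof.
move=> oD; elim: k f => [|k IH] f /= => [cf x Dx|[df Cf]].
  by apply: cvgN; exact: cf.
split=> [x Dx|v]; first by apply: differentiableN; exact: df.
apply: class_C_eq (IH _ (Cf v)) => // x Dx /=.
by rewrite [RHS]deriveN //; apply: diff_derivable; exact: df.
Qed.

Lemma class_CM k D (f g : V -> R) : open D ->
  class_C k D f -> class_C k D g -> class_C k D (fun x => f x * g x).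
Proof.
move=> oD; elim: k f g => [|k IH] f g.
  move=> cf cg x Dx; apply: continuousM; [exact: cf|exact: cg].
move=> Cf Cg; have [df Cdf] := Cf; have [dg Cdg] := Cg.
split=> [x Dx|v]; first by apply: differentiableM; [exact: df|exact: dg].
have C := class_CD oD (IH _ _ (class_CW Cf) (Cdg v)) (IH _ _ (class_CW Cg) (Cdf v)).
apply: class_C_eq C => // x Dx /=.
by rewrite [RHS]deriveM //; apply: diff_derivable; [exact: df|exact: dg].
Qed.

Lemma class_CV k D (f : V -> R) : open D -> (forall x, D x -> f x != 0) ->
  class_C k D f -> class_C k D (fun x => (f x)^-1).
Proof.
move=> oD f0; elim: k => [cf x Dx|k IH Cf].
  by apply: cvgV; [exact: f0|exact: cf].
have [df Cdf] := Cf.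
have dV x (Dx : D x) : differentiable (fun x => (f x)^-1) x.
  by apply: differentiableV; [exact: df|exact: f0].
split=> // v; have CV := IH (class_CW Cf).
have C := class_CN oD (class_CM oD (class_CM oD CV CV) (Cdf v)).
apply: class_C_eq C => // x Dx /=.
rewrite [RHS]deriveV ?f0 //; last exact/diff_derivable/df.
by rewrite expr2 invfM scaleNr.
Qed.

Lemma differentiable_sqrt (f : V -> R) x : differentiable f x -> 0 < f x ->
  differentiable (fun y => Num.sqrt (f y)) x.
Proof.
move=> df f0; apply: (differentiable_comp df); apply/derivable1_diffP.
by case: (is_derive1_sqrt f0).
Qed.

(** By induction on [k], since the derivative of [sqrt f] is a quotient of that of
    [f] by [sqrt f] itself. *)
Lemma class_C_sqrt k D (f : V -> R) : open D -> (forall x, D x -> 0 < f x) ->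
  class_C k D f -> class_C k D (fun x => Num.sqrt (f x)).
Proof.
move=> oD f0; elim: k => [cf x Dx|k IH Cf].
  by apply: (continuous_comp (cf x Dx)); exact: sqrt_continuous.
have [df Cdf] := Cf.
split=> [x Dx|v]; first by apply: differentiable_sqrt; [exact: df|exact: f0].
have s0 x : D x -> Num.sqrt (f x) != 0 by move=> /f0 ?; rewrite gt_eqF ?sqrtr_gt0.
have CV := class_CV oD s0 (IH (class_CW Cf)).
have C := class_CM oD (class_CM oD (class_C_cst k D (2^-1 : R)) CV) (Cdf v).
apply: class_C_eq C => // x Dx /=.
have dfx := df x Dx; have fx0 := f0 x Dx.
have dsf := differentiable_sqrt dfx fx0.
(* The derivative of [sqrt f] comes from the identity [f = sqrt f * sqrt f]. *)
have -> : 'D_v f x = 'D_v ((fun y => Num.sqrt (f y)) * (fun y => Num.sqrt (f y))) x.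
  apply: near_eq_derive; apply: (near_open oD Dx) => y Dy.
  by rewrite !fctE -expr2 sqr_sqrtr // ltW // f0.
rewrite deriveM //; [|exact: diff_derivable..].
rewrite !scalerE; have := s0 x Dx.
by move: ('D_v _ _) (Num.sqrt _) => a b b0; field.
Qed.

Lemma differential_basis n (W : normedModType R) (g : 'rV[R]_n -> W) y w :
  differentiable g y -> 'D_w g y = \sum_i w 0 i *: 'D_(delta_mx 0 i) g y.
Proof.
move=> dg; rewrite deriveE // {1}(row_sum_coord w) linear_sum.
by apply: eq_bigr => i _; rewrite linearZ deriveE.
Qed.

Lemma class_C_sum n k D (f : 'I_n -> V -> R) : open D ->
  (forall i, class_C k D (f i)) -> class_C k D (fun x => \sum_i f i x).
Proof.
move=> oD Cf.
rewrite (_ : (fun x => _) = \sum_i f i); last by apply/funext => x; rewrite fct_sumE.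
apply: (big_ind (class_C k D)) => [|f1 f2|i _]; last exact: Cf.
  exact: (class_C_cst k D (0 : R)).
exact: class_CD.
Qed.

Lemma derive_comp (W W' : normedModType R) (f : V -> W) (g : W -> W') x v :
  differentiable f x -> differentiable g (f x) ->
  'D_v (g \o f) x = 'D_('D_v f x) g (f x).
Proof.
move=> df dg; rewrite [LHS]deriveE; last exact: differentiable_comp.
by rewrite diff_comp //= [RHS]deriveE // deriveE.
Qed.

(** The chain rule is expanded over partial derivatives, so that the induction
    hypothesis applies to each of them composed with [f]. *)
Lemma class_C_comp n k D (E : set 'rV[R]_n) (f : V -> 'rV[R]_n) (g : 'rV[R]_n -> R) :
  open D -> (forall x, D x -> E (f x)) ->
  class_C k D f -> class_C k E g -> class_C k D (g \o f).
Proof.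
move=> oD DE; elim: k f g DE => [|k IH] f g DE.
  move=> cf cg x Dx; apply: (continuous_comp (cf x Dx)); exact/cg/DE.
move=> Cf [dg Cg]; have [df Cdf] := Cf.
split=> [x Dx|v]; first by apply: differentiable_comp; [exact: df|exact/dg/DE].
have C : class_C k D (fun x => \sum_i ('D_v f x) 0 i * 'D_(delta_mx 0 i) g (f x)).
  apply: class_C_sum => // i; apply: class_CM => //.
    by have /class_C_rowP := Cdf v; apply.
  exact: (IH _ _ DE (class_CW Cf) (Cg _)).
apply: class_C_eq C => // x Dx; have dfx := df x Dx; have dgx := dg _ (DE x Dx).
by rewrite [RHS]derive_comp // [RHS]differential_basis.
Qed.

End ClassC.

(** * Smooth functions *)

Section Smooth.
Context {R : realType} {V : normedModType R}.
Implicit Types (D : set V).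

Lemma smooth_on_eq (W : normedModType R) D (f g : V -> W) : open D ->
  (forall x, D x -> f x = g x) -> smooth_on D f -> smooth_on D g.
Proof. by move=> oD fg Sf k; exact: class_C_eq fg (Sf k). Qed.

Lemma smooth_on_sub (W : normedModType R) D D' (f : V -> W) :
  D' `<=` D -> smooth_on D f -> smooth_on D' f.
Proof. by move=> sD Sf k; exact: class_C_sub (Sf k). Qed.

Lemma smooth_on_differentiable (W : normedModType R) D (f : V -> W) x :
  smooth_on D f -> D x -> differentiable f x.
Proof. by move=> Sf; have [+ _] := Sf 1%N; apply. Qed.

Lemma smooth_on_continuous (W : normedModType R) D (f : V -> W) x :
  smooth_on D f -> D x -> {for x, continuous f}.
Proof. by move=> Sf Dx; exact: (Sf 0%N). Qed.

Lemma smooth_on_derive (W : normedModType R) D (f : V -> W) v :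
  smooth_on D f -> smooth_on D ('D_v f).
Proof. by move=> Sf k; have [_] := Sf k.+1; apply. Qed.

Lemma smooth_on_cst (W : normedModType R) D (w : W) : smooth_on D (fun=> w).
Proof. by move=> k; exact: class_C_cst. Qed.

Lemma smooth_on_id D : smooth_on D (fun x : V => x).
Proof. by move=> k; exact: class_C_id. Qed.

Lemma smooth_on_linear (W W' : normedModType R) D (T : {linear W -> W'}) (f : V -> W) :
  open D -> continuous T -> smooth_on D f -> smooth_on D (fun x => T (f x)).
Proof. by move=> oD cT Sf k; exact: class_C_linear_comp (Sf k). Qed.

Lemma smooth_on_pair (W W' : normedModType R) D (f : V -> W) (g : V -> W') :
  open D -> smooth_on D f -> smooth_on D g -> smooth_on D (fun x => (f x, g x)).
Proof. by move=> oD Sf Sg k; exact: class_C_pair. Qed.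

Lemma smooth_on_rowP n D (f : V -> 'rV[R]_n) : open D ->
  smooth_on D f <-> forall i, smooth_on D (fun x => f x 0 i : R).
Proof.
move=> oD; split=> [Sf i k|Sf k]; last by apply/class_C_rowP => // i; exact: Sf.
by have /class_C_rowP := Sf k; apply.
Qed.

Lemma smooth_onD (W : normedModType R) D (f g : V -> W) : open D ->
  smooth_on D f -> smooth_on D g -> smooth_on D (fun x => f x + g x).
Proof. by move=> oD Sf Sg k; exact: class_CD. Qed.

Lemma smooth_onN (W : normedModType R) D (f : V -> W) : open D ->
  smooth_on D f -> smooth_on D (fun x => - f x).
Proof. by move=> oD Sf k; exact: class_CN. Qed.

Lemma smooth_onB (W : normedModType R) D (f g : V -> W) : open D ->
  smooth_on D f -> smooth_on D g -> smooth_on D (fun x => f x - g x).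
Proof. by move=> oD Sf Sg; apply: smooth_onD => //; exact: smooth_onN. Qed.

Lemma smooth_onM D (f g : V -> R) : open D ->
  smooth_on D f -> smooth_on D g -> smooth_on D (fun x => f x * g x).
Proof. by move=> oD Sf Sg k; exact: class_CM. Qed.

Lemma smooth_onV D (f : V -> R) : open D -> (forall x, D x -> f x != 0) ->
  smooth_on D f -> smooth_on D (fun x => (f x)^-1).
Proof. by move=> oD f0 Sf k; exact: class_CV. Qed.

Lemma smooth_on_sqrt D (f : V -> R) : open D -> (forall x, D x -> 0 < f x) ->
  smooth_on D f -> smooth_on D (fun x => Num.sqrt (f x)).
Proof. by move=> oD f0 Sf k; exact: class_C_sqrt. Qed.

Lemma smooth_on_sum n D (f : 'I_n -> V -> R) : open D ->
  (forall i, smooth_on D (f i)) -> smooth_on D (fun x => \sum_i f i x).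
Proof. by move=> oD Sf k; apply: class_C_sum => // i; exact: Sf. Qed.

Lemma smooth_on_comp n m D (E : set 'rV[R]_n) (f : V -> 'rV[R]_n)
    (g : 'rV[R]_n -> 'rV[R]_m) :
  open D -> open E -> (forall x, D x -> E (f x)) ->
  smooth_on D f -> smooth_on E g -> smooth_on D (fun x => g (f x)).
Proof.
move=> oD oE DE Sf Sg; apply/smooth_on_rowP => // i k.
exact: (class_C_comp oD DE (Sf k) ((class_C_rowP k g oE).1 (Sg k) i)).
Qed.

Lemma smooth_onZ n D (a : V -> R) (f : V -> 'rV[R]_n) : open D ->
  smooth_on D a -> smooth_on D f -> smooth_on D (fun x => a x *: f x).
Proof.
move=> oD Sa Sf; apply/smooth_on_rowP => // i.
apply: (@smooth_on_eq _ _ (fun x => a x * f x 0 i)) => //.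
  by move=> x Dx; rewrite mxE.
by apply: smooth_onM => //; have /smooth_on_rowP := Sf; apply.
Qed.

Lemma smooth_on_mulmx n m D (f : V -> 'rV[R]_n) (B : 'M[R]_(n, m)) : open D ->
  smooth_on D f -> smooth_on D (fun x => f x *m B).
Proof.
move=> oD Sf; apply/smooth_on_rowP => // i.
apply: (@smooth_on_eq _ _ (fun x => \sum_j f x 0 j * B j i)) => //.
  by move=> x Dx; rewrite mxE.
apply: smooth_on_sum => // j; apply: smooth_onM => //; last exact: smooth_on_cst.
by have /smooth_on_rowP := Sf; apply.
Qed.

Lemma smooth_on_dot D (f g : V -> E3 R) : open D ->
  smooth_on D f -> smooth_on D g -> smooth_on D (fun x => dot (f x) (g x)).
Proof.
move=> oD Sf Sg; apply: smooth_on_sum => // i.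
exact: smooth_onM ((smooth_on_rowP f oD).1 Sf i) ((smooth_on_rowP g oD).1 Sg i).
Qed.

Lemma derive_dot (f g : V -> E3 R) x v :
  differentiable f x -> differentiable g x ->
  'D_v (fun y => dot (f y) (g y)) x = dot ('D_v f x) (g x) + dot (f x) ('D_v g x).
Proof.
move=> df dg.
rewrite (_ : (fun y => _) = \sum_i ((fun y => f y 0 i) * (fun y => g y 0 i))); last first.
  by apply/funext => y; rewrite fct_sumE.
have df' i : derivable (fun y => f y 0 i) x v.
  by apply: diff_derivable; move: i; apply/differentiable_rowP.
have dg' i : derivable (fun y => g y 0 i) x v.
  by apply: diff_derivable; move: i; apply/differentiable_rowP.
rewrite derive_sum; last by move=> i; apply: derivableM.
rewrite /dot -big_split; apply: eq_bigr => i _ /=.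
by rewrite deriveM // !derive_row // !scalerE; ring.
Qed.

Lemma derive_scale n (a : V -> R) (f : V -> 'rV[R]_n) x v :
  differentiable a x -> differentiable f x ->
  'D_v (fun y => a y *: f y) x = 'D_v a x *: f x + a x *: 'D_v f x.
Proof.
move=> da df.
have df' i : differentiable (fun y => f y 0 i : R) x by move: i; apply/differentiable_rowP.
have daf : differentiable (fun y => a y *: f y) x.
  apply/differentiable_rowP => i.
  rewrite (_ : (fun y => _) = a * (fun y => f y 0 i)); first exact: differentiableM.
  by apply/funext => y; rewrite mxE.
apply/rowP => i; rewrite derive_row // !mxE derive_row //.
rewrite (_ : (fun y => _) = a * (fun y => f y 0 i)); last first.
  by apply/funext => y; rewrite mxE.
by rewrite deriveM; [rewrite !scalerE; ring|exact: diff_derivable..].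
Qed.

Lemma derive_mulmx n m (f : V -> 'rV[R]_n) (B : 'M[R]_(n, m)) x v :
  differentiable f x -> 'D_v (fun y => f y *m B) x = 'D_v f x *m B.
Proof.
move=> df.
have df' i : derivable (fun y => f y 0 i) x v.
  by apply: diff_derivable; move: i; apply/differentiable_rowP.
rewrite derive_mx; last first.
  apply/derivable_mxP => i j; rewrite ord1.
  rewrite (_ : (fun y => _) = \sum_k ((fun y => f y 0 k) * cst (B k j))).
    by apply: derivable_sum => k; apply: derivableM.
  by apply/funext => y; rewrite mxE fct_sumE.
apply/rowP => j; rewrite !mxE.
rewrite (_ : (fun y => _) = \sum_k ((fun y => f y 0 k) * cst (B k j))); last first.
  by apply/funext => y; rewrite mxE fct_sumE.
rewrite derive_sum => [|k]; last exact: derivableM.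
apply: eq_bigr => k _.
by rewrite deriveM // derive_cst scaler0 add0r scalerE /= [X in _ = X * _]derive_row // mulrC.
Qed.

Lemma differentiable_mulmx n m (f : V -> 'rV[R]_n) (B : 'M[R]_(n, m)) x :
  differentiable f x -> differentiable (fun y => f y *m B) x.
Proof.
move=> /differentiable_rowP df; apply/differentiable_rowP => j.
rewrite (_ : (fun y => _) = \sum_k ((fun y => f y 0 k) * cst (B k j))).
  by apply: differentiable_sum => k; apply: differentiableM.
by apply/funext => y; rewrite mxE fct_sumE.
Qed.

Lemma differentiable_dot (f g : V -> E3 R) x :
  differentiable f x -> differentiable g x ->
  differentiable (fun y => dot (f y) (g y)) x.
Proof.
move=> /differentiable_rowP df /differentiable_rowP dg.
rewrite (_ : (fun y => _) = \sum_i ((fun y => f y 0 i) * (fun y => g y 0 i))).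
  by apply: differentiable_sum => i; apply: differentiableM.
by apply/funext => y; rewrite fct_sumE.
Qed.

End Smooth.

(** * Vector algebra in the Euclidean space *)

Section Euclid.
Context {R : realType}.
Implicit Types (u v w a b c : E3 R) (k : R).

Lemma dotE u v : dot u v = u 0 0 * v 0 0 + u 0 1 * v 0 1 + u 0 2%:R * v 0 2%:R.
Proof.
rewrite /dot !big_ord_recl big_ord0 addr0 addrA.
by congr (_ * _ + _ * _ + _ * _); congr (_ 0 _); apply/val_inj.
Qed.

Lemma dotC u v : dot u v = dot v u.
Proof. by apply: eq_bigr => i _; rewrite mulrC. Qed.

Lemma dotDl u v w : dot (u + v) w = dot u w + dot v w.
Proof. by rewrite -big_split; apply: eq_bigr => i _; rewrite mxE mulrDl. Qed.

Lemma dotZl k u w : dot (k *: u) w = k * dot u w.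
Proof. by rewrite /dot mulr_sumr; apply: eq_bigr => i _; rewrite mxE mulrA. Qed.

Lemma dotDr u v w : dot w (u + v) = dot w u + dot w v.
Proof. by rewrite dotC dotDl !(dotC w). Qed.

Lemma dotZr k u w : dot w (k *: u) = k * dot w u.
Proof. by rewrite dotC dotZl dotC. Qed.

Lemma dotNl u w : dot (- u) w = - dot u w.
Proof. by rewrite -scaleN1r dotZl mulN1r. Qed.

Lemma dotNr u w : dot w (- u) = - dot w u.
Proof. by rewrite dotC dotNl dotC. Qed.

Lemma dot0l u : dot 0 u = 0.
Proof. by rewrite -(scale0r u) dotZl mul0r. Qed.

Lemma dot0r u : dot u 0 = 0.
Proof. by rewrite dotC dot0l. Qed.

Definition dot_lin := (dotDl, dotDr, dotZl, dotZr, dotNl, dotNr, dot0l, dot0r).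

Lemma dot_ge0 u : 0 <= dot u u.
Proof. by apply: sumr_ge0 => i _; rewrite -expr2 sqr_ge0. Qed.

Lemma dot_eq0 u : (dot u u == 0) = (u == 0).
Proof.
apply/eqP/eqP => [|->]; last by rewrite dot0l.
move/psumr_eq0P => u0; apply/rowP => i; rewrite mxE.
have /eqP := u0 (fun i _ => eq_ind _ (fun x => is_true (0 <= x)) (sqr_ge0 (u 0 i)) _ (expr2 _)) i isT.
by rewrite mulf_eq0 orbb => /eqP.
Qed.

Lemma enorm1 u : enorm u = 1 -> dot u u = 1.
Proof. by move=> /(congr1 (fun x => x ^+ 2)); rewrite sqr_sqrtr ?dot_ge0 // expr1n. Qed.

(** Indices of coordinates are added modulo 3. *)
Definition cross u v : E3 R :=
  \row_j (u 0 (j + 1) * v 0 (j + 2%:R) - u 0 (j + 2%:R) * v 0 (j + 1)).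

Lemma cross_coord u v :
  (cross u v 0 0 = u 0 1 * v 0 2%:R - u 0 2%:R * v 0 1) *
  (cross u v 0 1 = u 0 2%:R * v 0 0 - u 0 0 * v 0 2%:R) *
  (cross u v 0 2%:R = u 0 0 * v 0 1 - u 0 1 * v 0 0).
Proof.
by split; [split|]; rewrite !mxE;
  congr (_ * _ - _ * _); congr (_ 0 _); apply/val_inj.
Qed.

Lemma row3P u v : [/\ u 0 0 = v 0 0, u 0 1 = v 0 1 & u 0 2%:R = v 0 2%:R] -> u = v.
Proof.
case=> e0 e1 e2; apply/rowP => -[[|[|[|//]]] lt_i3].
- by move: e0; congr (u 0 _ = v 0 _); apply/val_inj.
- by move: e1; congr (u 0 _ = v 0 _); apply/val_inj.
- by move: e2; congr (u 0 _ = v 0 _); apply/val_inj.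
Qed.

Lemma dot_crossl a b : dot a (cross a b) = 0.
Proof. by rewrite dotE !cross_coord; ring. Qed.

Lemma dot_crossr a b : dot b (cross a b) = 0.
Proof. by rewrite dotE !cross_coord; ring. Qed.

Lemma cross_combl s t a b : cross (s *: a + t *: b) b = s *: cross a b.
Proof. by apply/rowP => j; rewrite !mxE; ring. Qed.

Lemma cross_combr s t a b : cross a (s *: a + t *: b) = t *: cross a b.
Proof. by apply/rowP => j; rewrite !mxE; ring. Qed.

(** Cramer's rule in the frame [a], [b], [cross a b], with denominators cleared. *)
Lemma cross_frame a b c :
  dot (cross a b) (cross a b) *: c = dot (cross c b) (cross a b) *: a +
    dot (cross a c) (cross a b) *: b + dot c (cross a b) *: cross a b.
Proof.
have Z i j (M : E3 R) (k : R) : (k *: M) i j = k * M i j by rewrite mxE.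
have A i j (M M' : E3 R) : (M + M') i j = M i j + M' i j by rewrite mxE.
by apply: row3P; split; rewrite !(Z, A) !dotE !cross_coord; ring.
Qed.

Lemma dot_comb_cross s t a b : dot (s *: a + t *: b) (cross a b) = 0.
Proof. by rewrite !dot_lin dot_crossl dot_crossr !mulr0 addr0. Qed.

Lemma orthogonal_cross_comb a b w : cross a b != 0 -> dot w (cross a b) = 0 ->
  exists s t, w = s *: a + t *: b.
Proof.
rewrite -dot_eq0 => N0 w0; have := cross_frame a b w; rewrite w0 scale0r addr0 => wE.
exists (dot (cross w b) (cross a b) / dot (cross a b) (cross a b)).
exists (dot (cross a w) (cross a b) / dot (cross a b) (cross a b)).
apply: (scalerI N0); rewrite wE scalerDr !scalerA.
by congr (_ *: _ + _ *: _); rewrite mulrC divfK.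
Qed.

Lemma orthogonal_frame_cross a b n : cross a b != 0 -> dot n a = 0 -> dot n b = 0 ->
  exists mu, n = mu *: cross a b.
Proof.
move=> N0 na nb; pose mu := dot n (cross a b) / dot (cross a b) (cross a b).
exists mu; apply/eqP; rewrite -subr_eq0.
have : dot (n - mu *: cross a b) (cross a b) = 0.
  by rewrite !dot_lin divfK ?subrr // dot_eq0.
move=> /(orthogonal_cross_comb N0)[s [t e]].
rewrite -dot_eq0 {2}e !dot_lin na nb !(dotC (cross a b)) dot_crossl dot_crossr.
by rewrite !(mulr0, oppr0, addr0).
Qed.

Lemma cross_neq0 a b : (forall s t, s *: a + t *: b = 0 -> s = 0 /\ t = 0) ->
  cross a b != 0.
Proof.
move=> free; apply/eqP => N0.
have E : dot a a * dot b b - dot a b * dot a b = dot (cross a b) (cross a b).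
  by rewrite !dotE !cross_coord; ring.
move: E; rewrite N0 dot0l => E.
have /free [b0 _] : dot b b *: a + (- dot a b) *: b = 0.
  apply/eqP; rewrite -dot_eq0 !dot_lin (dotC b a); apply/eqP.
  transitivity (dot b b * (dot a a * dot b b - dot a b * dot a b)); first ring.
  by rewrite E mulr0.
have /free [_ /eqP] : 0 *: a + 1 *: b = 0.
  by rewrite scale0r add0r scale1r; apply/eqP; rewrite -dot_eq0 b0.
by rewrite oner_eq0.
Qed.

End Euclid.

(** * Immersions *)

Section Immersions.
Context {R : realType} {n m : nat}.
Implicit Types (D : set 'rV[R]_n) (phi : 'rV[R]_n -> 'rV[R]_m).

Lemma coord_le_norm (k : nat) (w : 'rV[R]_k) i : `|w 0 i| <= `|w|.
Proof. by rewrite [leRHS]/Num.Def.normr/= mx_normrE; exact: (le_bigmax _ _ (0, i)). Qed.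

Lemma norm_le_coord (k : nat) (w : 'rV[R]_k) (M : R) : 0 <= M ->
  (forall i, `|w 0 i| <= M) -> `|w| <= M.
Proof.
move=> M0 wM; rewrite [leLHS]/Num.Def.normr/= mx_normrE bigmax_le //= => -[i j] _.
by rewrite ord1.
Qed.

Lemma mulmx_lipschitz (k l : nat) (B : 'M[R]_(k, l)) :
  exists2 K : R, 0 < K & forall w : 'rV[R]_k, `|w *m B| <= K * `|w|.
Proof.
apply: (@linear_lipschitz R 'rV[R]_k 'rV[R]_l (mulmxr B)) => w /=.
apply: (@smooth_on_continuous _ _ _ setT (fun w : 'rV[R]_k => w *m B)) => //.
by apply: smooth_on_mulmx; [exact: openT|exact: smooth_on_id].
Qed.

Lemma linear_left_inverse (f : {linear 'rV[R]_n -> 'rV[R]_m}) : injective f ->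
  exists B : 'M[R]_(m, n), forall w, f w *m B = w.
Proof.
move=> injf.
have /row_freeP[B AB] : row_free (lin1_mx f).
  apply: inj_row_free => v; rewrite mul_rV_lin1 => fv0.
  by apply: injf; rewrite fv0 linear0.
by exists B => w; rewrite -mul_rV_lin1 -mulmxA AB mulmx1.
Qed.

Lemma diff_error (V W : normedModType R) (f : V -> W) x (eps : R) :
  differentiable f x -> 0 < eps ->
  \forall y \near x, `|f y - f x - 'D_(y - x) f x| <= eps * `|y - x|.
Proof.
move=> df eps0; have /diff_locally/eqaddoP/(_ _ eps0) := df.
rewrite near_simpl /= => fo; rewrite (near_shift 0) /=; apply: filterS fo => y.
by rewrite !fctE /= opprD addrA subr0 addrK deriveE.
Qed.

Lemma differentiable_lipschitz (V W : normedModType R) (f : V -> W) x :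
  differentiable f x ->
  exists2 C : R, 0 < C & \forall y \near x, `|f y - f x| <= C * `|y - x|.
Proof.
move=> df; have [K K0 dfK] := linear_lipschitz (diff_continuous df).
exists (1 + K); first by rewrite addr_gt0.
near=> y; rewrite -(subrK ('D_(y - x) f x) (f y - f x)) mulrDl.
apply: le_trans (ler_normD _ _) _; apply: lerD.
  by near: y; exact: diff_error.
by rewrite deriveE.
Unshelve. all: by end_near. Qed.

Lemma injective_derive phi x v : differentiable phi x -> injective ('d phi x) ->
  'D_v phi x = 0 -> v = 0.
Proof. by move=> dphi inj; rewrite deriveE // => e; apply: inj; rewrite e linear0. Qed.

Lemma derive_injective (V W : normedModType R) (f : V -> W) x : differentiable f x ->
  (forall v, 'D_v f x = 0 -> v = 0) -> injective ('d f x).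
Proof.
move=> df f0 v w e; apply/eqP; rewrite -subr_eq0; apply/eqP/f0.
by rewrite deriveE // linearB /= e subrr.
Qed.

(** With [B] a left inverse of the differential of [phi] at [z y0], [z] is
    [P *m B] up to a remainder which is negligible before [z y - z y0].
    As [z] is continuous, the remainder is absorbed to give
    [z y - z y0 = O(y - y0)], so it is also negligible before [y - y0]. *)
Lemma differentiable_lift (V : normedModType R) phi (z : V -> 'rV[R]_n)
    (P : V -> 'rV[R]_m) y0 :
  differentiable phi (z y0) -> injective ('d phi (z y0)) ->
  {for y0, continuous z} -> (\forall y \near y0, phi (z y) = P y) ->
  differentiable P y0 -> differentiable z y0.
Proof.
move=> dphi inj cz lift dP.
have [B AB] := linear_left_inverse inj.
pose r x := phi x *m B - x.
have dPB := differentiable_mulmx B dP.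
have rE (eps : R) : 0 < eps -> \forall y \near y0,
    `|r (z y) - r (z y0)| <= eps * `|z y - z y0|.
  move=> eps0; apply: (cz (fun x => `|r x - r (z y0)| <= eps * `|x - z y0|)).
  have dr : differentiable r (z y0).
    by apply: differentiableB => //; exact: differentiable_mulmx.
  have := diff_error dr eps0; apply: filterS => x.
  suff -> : 'D_(x - z y0) r (z y0) = 0 by rewrite subr0.
  rewrite deriveB; [|exact/diff_derivable/differentiable_mulmx|exact: diff_derivable].
  by rewrite derive_mulmx // deriveE // AB derive_id subrr.
have zE : \forall y \near y0, z y - z y0 = (P y *m B - P y0 *m B) - (r (z y) - r (z y0)).
  have e0 := nbhs_singleton lift.
  by near=> y; rewrite /r (near lift y) // e0; apply/rowP => i; rewrite !mxE; ring.
have [C C0 PC] := differentiable_lipschitz dPB.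
have zC : \forall y \near y0, `|z y - z y0| <= (2 * C) * `|y - y0|.
  near=> y.
  have e1 : `|z y - z y0| <= C * `|y - y0| + 2^-1 * `|z y - z y0|.
    rewrite {1}(near zE y) //; apply: le_trans (ler_normB _ _) _; apply: lerD.
      by near: y.
    by near: y; apply: rE; rewrite invr_gt0.
  by rewrite -mulrA; lra.
suff e0 : differentiable (fun y => r (z y) - r (z y0)) y0.
  have dd : differentiable
    (fun y => z y0 + ((P y *m B - P y0 *m B) - (r (z y) - r (z y0)))) y0.
    apply: differentiableD; first exact: differentiable_cst.
    apply: differentiableB => //; apply: differentiableB => //.
  apply: differentiable_near dd; near=> y.
  by rewrite -(near zE y) // addrC subrK.
apply: differentiable_littleo => eps eps0.
have eC0 : 0 < eps / (2 * C) by rewrite divr_gt0 // mulr_gt0.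
near=> y; apply: (@le_trans _ _ (eps / (2 * C) * `|z y - z y0|)).
  by near: y; exact: rE.
rewrite -mulrA ler_pM2l // ler_pdivrMl; last by rewrite mulr_gt0.
by near: y.
Unshelve. all: by end_near. Qed.

Lemma ball_segment (k : nat) (x0 x y : 'rV[R]_k) (e t : R) : 0 <= t <= 1 ->
  ball x0 e x -> ball x0 e y -> ball x0 e (y + t *: (x - y)).
Proof.
move=> /andP[t0 t1]; rewrite -!ball_normE /= => bx by_.
have -> : x0 - (y + t *: (x - y)) = (1 - t) *: (x0 - y) + t *: (x0 - x).
  by apply/rowP => i; rewrite !mxE; ring.
apply: le_lt_trans (ler_normD _ _) _; rewrite !normrZ.
rewrite (ger0_norm t0) ger0_norm ?subr_ge0 //.
have [->|t00] := eqVneq t 0; first by rewrite subr0 mul1r mul0r addr0.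
have t0' : 0 < t by rewrite lt_def t00.
have h1 : (1 - t) * `|x0 - y| <= (1 - t) * e by rewrite ler_wpM2l ?subr_ge0 // ltW.
have h2 : t * `|x0 - x| < t * e by rewrite ltr_pM2l.
by lra.
Qed.

(** An immersion is the identity up to a left inverse and a remainder [r] whose
    derivative vanishes at [x0]; the mean value theorem bounds the remainder. *)
Lemma immersion_bilipschitz phi D x0 : open D -> D x0 -> smooth_on D phi ->
  injective ('d phi x0) ->
  exists (c : R) (D' : set 'rV[R]_n), [/\ 0 < c, open D', D' x0, D' `<=` D &
    forall x y, D' x -> D' y -> c * `|x - y| <= `|phi x - phi y|].
Proof.
move=> oD Dx0 Sphi inj.
have [B AB] := linear_left_inverse inj.
have [K K0 BK] := mulmx_lipschitz B.
pose r x := phi x *m B - x.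
have Sr : smooth_on D r.
  by apply: smooth_onB => //; [exact: smooth_on_mulmx|exact: smooth_on_id].
have dphi := smooth_on_differentiable Sphi Dx0.
have Dr0 v : 'D_v r x0 = 0.
  rewrite deriveB; [|exact/diff_derivable/differentiable_mulmx|exact: diff_derivable].
  by rewrite derive_mulmx // deriveE // AB derive_id subrr.
(* The [n] partial derivatives of [r] must add up to at most one half. *)
pose e : R := (2 * n.+1%:R)^-1.
have e0 : 0 < e by rewrite invr_gt0 mulr_gt0.
have small : \forall x \near x0, D x /\
    forall j : 'I_n, `|'D_(delta_mx 0 j) r x| <= e.
  near=> x; split; first by near: x; exact: open_nbhs_nbhs.
  move=> j; move: j; near: x; apply: filter_forall => j.
  have := smooth_on_continuous (smooth_on_derive (delta_mx 0 j) Sr) Dx0.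
  move=> /cvgrPdist_le /(_ _ e0); rewrite Dr0.
  by apply: filterS => x; rewrite sub0r normrN.
have /nbhs_ballP[d /= d0 dsmall] := small.
exists (2 * K)^-1, (ball x0 d); split.
- by rewrite invr_gt0 mulr_gt0.
- exact: ball_open.
- exact: ballxx.
- by move=> x /dsmall[].
move=> x y bx by_.
have rL : `|r x - r y| <= 2^-1 * `|x - y|.
  apply: norm_le_coord => [|i]; first by rewrite mulr_ge0.
  pose h (t : R) := r (y + t *: (x - y)) 0 i.
  have inD (t : R) : 0 <= t <= 1 -> ball x0 d (y + t *: (x - y)) by move=> t01; exact: ball_segment.
  have dl (t : R) : differentiable (fun t : R => y + t *: (x - y)) t.
    by apply: differentiableD => //; exact: differentiableZl.
  have Dl (t : R) : 'D_1 (fun t : R => y + t *: (x - y)) t = x - y.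
    rewrite deriveD ?derive_cst ?add0r; [|exact: diff_derivable..].
    rewrite (@derive_scale _ _ _ (fun t : R => t) (fun=> x - y)) //.
    by rewrite derive_id derive_cst scale1r scaler0 addr0.
  have drr (t : R) : 0 <= t <= 1 -> differentiable r (y + t *: (x - y)).
    by move=> /inD/dsmall[Dt _]; exact: smooth_on_differentiable Sr Dt.
  have dh (t : R) : 0 <= t <= 1 -> is_derive t 1 h (('D_(x - y) r (y + t *: (x - y))) 0 i).
    move=> t01.
    have dc : differentiable (fun t : R => r (y + t *: (x - y))) t.
      by apply: (differentiable_comp (dl t)); exact: drr.
    apply: DeriveDef.
      by apply: diff_derivable; move/differentiable_rowP: dc; apply.
    rewrite /h -(derive_row _ _ dc).
    by rewrite (derive_comp (f := fun t : R => y + t *: (x - y)) _ (dl t)) ?Dl //; exact: drr.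
  have [t tt||c c01] := @MVT_segment R h (fun t => ('D_(x - y) r (y + t *: (x - y))) 0 i) 0 1 ler01.
  - by apply: dh; rewrite !(itvP tt).
  - apply: continuous_in_subspaceT => t /set_mem /= tt.
    apply: differentiable_continuous; apply/derivable1_diffP.
    have t01 : 0 <= t <= 1 by rewrite !(itvP tt).
    by have [] := dh t t01.
  rewrite /h scale1r scale0r addr0 (addrC y) subrK subr0 mulr1 => hE.
  have -> : (r x - r y) 0 i = r x 0 i - r y 0 i by rewrite [LHS]mxE [(- r y) _ _]mxE.
  rewrite hE.
  have cc : 0 <= c <= 1 by rewrite !(itvP c01).
  have /inD/dsmall[_ sm] := cc.
  rewrite differential_basis; last exact: drr.
  rewrite summxE; apply: le_trans (ler_norm_sum _ _ _) _.
  apply: (@le_trans _ _ (\sum_(j < n) `|x - y| * e)).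
    apply: ler_sum => j _; rewrite mxE normrM ler_pM //; first exact: coord_le_norm.
    by apply: le_trans (coord_le_norm _ _) (sm j).
  rewrite sumr_const card_ord -mulrnAr mulrC ler_wpM2r // -mulr_natr.
  rewrite /e ler_pdivrMl ?mulr_gt0 // mulrAC divff ?pnatr_eq0 // mul1r.
  by rewrite ler_nat.
have xyE : x - y = (phi x - phi y) *m B - (r x - r y).
  by rewrite mulmxBl /r; apply/rowP => i; rewrite !mxE; ring.
have : `|x - y| <= K * `|phi x - phi y| + 2^-1 * `|x - y|.
  rewrite {1}xyE; apply: le_trans (ler_normB _ _) _.
  by apply: lerD rL; exact: BK.
move=> H; rewrite ler_pdivrMl; last by rewrite mulr_gt0.
by rewrite -mulrA; lra.
Unshelve. all: by end_near. Qed.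

End Immersions.

(** * Surfaces and their normal vectors *)

Section Surfaces.
Context {R : realType}.
Implicit Types (S : set (E3 R)) (phi : 'rV[R]_2 -> E3 R) (D : set 'rV[R]_2).

Lemma open_preimage (V W : normedModType R) (E : set V) (O : set W) (f : V -> W) :
  open E -> open O -> (forall x, E x -> {for x, continuous f}) ->
  open (E `&` f @^-1` O).
Proof.
move=> oE oO cf; rewrite openE => x [Ex Ofx]; apply: filterI.
  exact: open_nbhs_nbhs.
by apply: (cf x Ex); exact: open_nbhs_nbhs.
Qed.

(** The lower Lipschitz bound makes [phi] injective with injective differentials,
    and makes the image of [ball x r] contain the part of the surface that lies in
    [ball (phi x) (c * r)], whence the homeomorphism condition. *)
Lemma bilipschitz_parametrization phi D (c : R) : open D -> smooth_on D phi ->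
  0 < c -> (forall x y, D x -> D y -> c * `|x - y| <= `|phi x - phi y|) ->
  local_parametrization (phi @` D) phi D.
Proof.
move=> oD Sphi c0 bilip; split=> //.
- move=> x Dx; have dphi := smooth_on_differentiable Sphi Dx.
  apply: derive_injective => // v Dv0; apply/eqP/negPn/negP => v0.
  have c20 : 0 < c / 2 by rewrite divr_gt0.
  have : \forall y \near x, D y /\ `|phi y - phi x - 'D_(y - x) phi x| <= c / 2 * `|y - x|.
    apply: filterI; first exact: open_nbhs_nbhs.
    exact: (diff_error dphi c20).
  move=> /nbhs_ballP[d /= d0 dH].
  have nv0 : 0 < `|v| by rewrite normr_gt0.
  pose t := d / 2 / `|v|; have t0 : 0 < t by rewrite !divr_gt0.
  have [] := dH (x + t *: v).
    rewrite -ball_normE /= opprD addrA subrr sub0r normrN normrZ gtr0_norm //.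
    by rewrite divfK ?gt_eqF // gtr_pMr // invf_lt1 // ltr1n.
  have yx : x + t *: v - x = t *: v by rewrite addrAC subrr add0r.
  move=> Dy; rewrite yx (deriveE _ dphi) linearZZ -(deriveE _ dphi) Dv0 scaler0 subr0.
  have := bilip _ _ Dy Dx; rewrite yx => h1 h2.
  have ntv : 0 < `|t *: v| by rewrite normrZ mulr_gt0 // normr_gt0 gt_eqF.
  have := le_trans h1 h2; rewrite ler_pM2r //.
  by move=> ?; lra.
- move=> x y Dx Dy e; have := bilip _ _ Dx Dy.
  by rewrite e subrr normr0 pmulr_rle0 // normr_le0 subr_eq0 => /eqP.
- move=> D' oD' sD'.
  pose W := \bigcup_(xr in [set xr : 'rV[R]_2 * R | 0 < xr.2 /\ ball xr.1 xr.2 `<=` D'])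
    ball (phi xr.1) (c * xr.2).
  exists W; first by apply: bigcup_open => -[x r] /= [r0 _]; apply: ball_open; rewrite mulr_gt0.
  apply/seteqP; split => [_ [x D'x <-]|p [[y Dy <-] [[x r] /= [r0 xr]]]].
    split; first by exists x => //; exact: sD'.
    have /nbhs_ballP[r /= r0 xr] := open_nbhs_nbhs (conj oD' D'x).
    by exists (x, r) => //=; apply: ballxx; rewrite mulr_gt0.
  have D'x : D' x by apply: xr; exact: ballxx.
  rewrite -ball_normE /= => bp; exists y => //; apply: xr.
  rewrite -ball_normE /= -(ltr_pM2l c0); apply: le_lt_trans bp.
  by apply: bilip => //; exact: sD'.
Qed.

Lemma image_smooth_surface phi D (c : R) : open D -> smooth_on D phi ->
  0 < c -> (forall x y, D x -> D y -> c * `|x - y| <= `|phi x - phi y|) ->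
  smooth_surface (phi @` D).
Proof.
move=> oD Sphi c0 bilip p pD; exists phi, D; split=> //.
exact: bilipschitz_parametrization bilip.
Qed.

Lemma rel_open_smooth_surface S (B : set (E3 R)) :
  smooth_surface S -> rel_open S B -> smooth_surface B.
Proof.
move=> smS [A oO ->] p [Sp Op].
have [phi [D [[oD Sphi inj iphi homeo] [x Dx phix]]]] := smS p Sp.
exists phi, (D `&` phi @^-1` A); split; last by exists x => //; split=> //=; rewrite phix.
have sD : D `&` phi @^-1` A `<=` D by move=> ? [].
split.
- by apply: (open_preimage oD oO) => y Dy; exact: smooth_on_continuous Sphi Dy.
- exact: smooth_on_sub Sphi.
- by move=> y [/inj].
- by move=> y z [Dy _] [Dz _]; exact: iphi.
- move=> D' oD' sD'; have [W oW E] := homeo D' oD' (subset_trans sD' sD).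
  exists W => //; rewrite E; apply/seteqP; split => [q [Sq Wq]|q [[]]//].
  split=> //; split=> //; have : (phi @` D') q by rewrite E.
  by case=> y /sD' [_ /=] + <-.
Qed.

(** The parameter [z y] of the point [P y] of the surface depends continuously on
    [y], as parametrizations are homeomorphisms onto relatively open subsets. *)
Lemma lift_exists (V : normedModType R) S phi D (P : V -> E3 R) (E : set V) y0 x0 :
  local_parametrization S phi D -> open E -> E y0 -> D x0 -> P y0 = phi x0 ->
  (forall y, E y -> {for y, continuous P} /\ S (P y)) ->
  exists (E' : set V) (z : V -> 'rV[R]_2),
    [/\ open E', E' y0, E' `<=` E, z y0 = x0 &
      forall y, E' y -> [/\ D (z y), phi (z y) = P y & {for y, continuous z}]].
Proof.
move=> [oD Sphi inj iphi homeo] oE Ey0 Dx0 Py0 PE.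
have [W oW WE] := homeo D oD (@subset_refl _ _).
have phiP y : exists x, (E `&` P @^-1` W) y -> D x /\ phi x = P y.
  have [[Ey Wy]|?] := pselect ((E `&` P @^-1` W) y); last by exists 0.
  have : (S `&` W) (P y) by split=> //; case: (PE y Ey).
  by rewrite -WE => -[x Dx <-]; exists x.
have [z zP] := choice phiP.
have oE' : open (E `&` P @^-1` W) by apply: (open_preimage oE oW) => y /PE[].
have E'y0 : (E `&` P @^-1` W) y0.
  split=> //=; have : (phi @` D) (P y0) by exists x0.
  by rewrite WE => -[].
exists (E `&` P @^-1` W), z; split; [exact: oE'|exact: E'y0|exact: subIsetl| |].
  by have [Dz e] := zP _ E'y0; apply: iphi => //; rewrite e.
move=> y E'y; have [Dz e] := zP _ E'y; split=> // A Az.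
have oD' : open (D `&` A^°) by apply: openI => //; exact: open_interior.
have [W' oW' W'E] := homeo (D `&` A^°) oD' (@subIsetl _ _ _).
have W'Py : W' (P y).
  suff : (S `&` W') (P y) by case.
  by rewrite -W'E; exists (z y).
have [cP _] := PE y E'y.1.
have : \forall y' \near y, (E `&` P @^-1` W) y' /\ W' (P y').
  apply: filterI; first exact: open_nbhs_nbhs.
  by apply: cP; exact: open_nbhs_nbhs.
apply: filterS => y' [E'y' W'y'] /=; have [Dz' e'] := zP _ E'y'.
have : (S `&` W') (P y') by split=> //; case: (PE _ E'y'.1).
rewrite -W'E => -[x [Dx Ax] ex].
by rewrite (iphi (z y') x) // ?e' ?ex //; exact: interior_subset.
Qed.

Lemma lift_differentiable (V : normedModType R) S phi D (P : V -> E3 R)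
    (z : V -> 'rV[R]_2) (E' : set V) y :
  local_parametrization S phi D -> open E' -> E' y -> differentiable P y ->
  (forall y, E' y -> [/\ D (z y), phi (z y) = P y & {for y, continuous z}]) ->
  differentiable z y /\ forall v, 'D_v P y = 'D_('D_v z y) phi (z y).
Proof.
move=> [oD Sphi inj _ _] oE' E'y dP zP; have [Dz e cz] := zP _ E'y.
have dphi := smooth_on_differentiable Sphi Dz.
have lft : \forall y' \near y, phi (z y') = P y'.
  by apply: (near_open oE' E'y) => y' /zP[].
have dz : differentiable z y by apply: (differentiable_lift dphi _ cz lft dP); exact: inj.
split=> // v; rewrite -derive_comp //; apply: near_eq_derive.
by apply: filterS lft => y' /esym.
Qed.

Lemma tangent_derive S (f : 'rV[R]_2 -> E3 R) E x v : open E -> E x ->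
  smooth_on E f -> (forall y, E y -> S (f y)) -> tangent S (f x) ('D_v f x).
Proof.
move=> oE Ex Sf SE.
pose line (t : R^o) : 'rV[R]_2 := x + t *: v.
have Sline A : open A -> smooth_on A line.
  move=> oA; apply: smooth_onD => //; first exact: smooth_on_cst.
  by apply: smooth_onZ => //; [exact: smooth_on_id|exact: smooth_on_cst].
have oT : open (setT `&` line @^-1` E).
  by apply: (open_preimage openT oE) => t _; exact: smooth_on_continuous (Sline _ openT) I.
have T0 : (setT `&` line @^-1` E) 0 by split=> //=; rewrite /line scale0r addr0.
have Sg : smooth_on (setT `&` line @^-1` E) (fun t => f (line t)).
  by apply: (smooth_on_comp oT oE _ (Sline _ oT) Sf) => t [].
exists (fun t => f (line t)); split.
- by exists (setT `&` line @^-1` E).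
- by apply: (near_open oT T0) => t [_ /=]; exact: SE.
- by rewrite /line scale0r addr0.
- have l0 : line 0 = x by rewrite /line scale0r addr0.
  have dl : differentiable line 0 by apply: smooth_on_differentiable (Sline _ openT) _.
  have df : differentiable f (line 0) by rewrite l0; exact: smooth_on_differentiable Sf Ex.
  rewrite (derive_comp _ dl df) l0; congr ('D__ f x).
  rewrite deriveD; [|exact: derivable_cst|].
    rewrite derive_cst add0r (@derive_scale _ _ _ (fun t : R^o => t) (fun=> v)) //.
    by rewrite derive_id derive_cst scale1r scaler0 addr0.
  by apply: diff_derivable; exact: differentiableZl.
Qed.

(** A curve drawn on the surface lifts to a curve of parameters, differentiable
    by [lift_differentiable]. *)
Lemma tangent_parametrization S phi D x w : local_parametrization S phi D -> D x ->
  tangent S (phi x) w -> exists v, w = 'D_v phi x.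
Proof.
move=> lp Dx [g [[A [oA A0 Sg]] nearS g0 <-]].
have oE : open (A `&` [set t | S (g t)]^°) by apply: openI => //; exact: open_interior.
have [||E' [z [oE' E'0 _ z0 zP]]] := @lift_exists _ S phi D g _ 0 x lp oE _ Dx g0.
  by split.
  move=> t [At St]; split; first exact: smooth_on_continuous Sg At.
  exact: (interior_subset St).
have [|dz zD] := lift_differentiable lp oE' E'0 _ zP; first exact: smooth_on_differentiable Sg A0.
by exists ('D_1 z 0); rewrite zD z0.
Qed.

Lemma class_C_dot (V : normedModType R) k (A : set V) (f g : V -> E3 R) : open A ->
  class_C k A f -> class_C k A g -> class_C k A (fun x => dot (f x) (g x)).
Proof.
move=> oA Cf Cg; apply: class_C_sum => // i; apply: class_CM => //.
  exact: (class_C_rowP k f oA).1.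
exact: (class_C_rowP k g oA).1.
Qed.

Lemma class_C_cross (V : normedModType R) k (A : set V) (f g : V -> E3 R) : open A ->
  class_C k A f -> class_C k A g -> class_C k A (fun x => cross (f x) (g x)).
Proof.
move=> oA Cf Cg; apply/class_C_rowP => // i.
have Cfi := (class_C_rowP k f oA).1 Cf; have Cgi := (class_C_rowP k g oA).1 Cg.
have C := class_CD oA (class_CM oA (Cfi (i + 1)) (Cgi (i + 2%:R)))
  (class_CN oA (class_CM oA (Cfi (i + 2%:R)) (Cgi (i + 1)))).
by apply: class_C_eq C => // x Ax; rewrite mxE.
Qed.

Lemma ord2_sum (W : lmodType R) (v : 'rV[R]_2) (F : 'I_2 -> W) :
  \sum_i v 0 i *: F i = v 0 0 *: F 0 + v 0 1 *: F 1.
Proof.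
rewrite !big_ord_recl big_ord0 addr0.
by congr (_ *: _ + _ *: _); [congr (v 0 _)|congr F]; apply/val_inj.
Qed.

(** The normal field is the cross product of the partial derivatives of a
    parametrization, evaluated at the parameter [z y] of the point [P y]; [z]
    is smooth because its derivative is a rational expression in the
    derivative of [P] and in [z] itself. *)
Lemma smooth_normal_along (V : normedModType R) S (P : V -> E3 R) (E : set V) y0 :
  smooth_surface S -> open E -> E y0 -> smooth_on E P -> (forall y, E y -> S (P y)) ->
  exists (E' : set V) (N : V -> E3 R),
    [/\ open E', E' y0, E' `<=` E, smooth_on E' N &
      forall y, E' y ->
        [/\ N y != 0,
            forall v, dot ('D_v P y) (N y) = 0,
            forall v, 'D_v P y = 0 -> 'D_v N y = 0,
            forall w, dot w (N y) = 0 -> tangent S (P y) w &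
            forall n, orthogonal_to S (P y) n -> exists mu, n = mu *: N y]].
Proof.
move=> smS oE Ey0 SP SE.
have [phi [D [lp [x0 Dx0 px0]]]] := smS _ (SE _ Ey0).
have [|E' [z [oE' E'0 sE' z0 zP]]] := lift_exists lp oE Ey0 Dx0 (esym px0).
  by move=> y Ey; split; [exact: smooth_on_continuous SP Ey|exact: SE].
have [oD Sphi inj _ _] := lp.
pose a := 'D_(delta_mx 0 0) phi; pose b := 'D_(delta_mx 0 1) phi.
pose M x := cross (a x) (b x).
have phiD x v : D x -> 'D_v phi x = v 0 0 *: a x + v 0 1 *: b x.
  move=> Dx; rewrite differential_basis ?ord2_sum //.
  exact: smooth_on_differentiable Sphi Dx.
have Sa : smooth_on D a by exact: smooth_on_derive.
have Sb : smooth_on D b by exact: smooth_on_derive.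
have SM : smooth_on D M by move=> k; exact: class_C_cross oD (Sa k) (Sb k).
have free x : D x -> forall s t, s *: a x + t *: b x = 0 -> s = 0 /\ t = 0.
  move=> Dx s t st.
  have : (\row_j (if j == 0 then s else t) : 'rV[R]_2) = 0.
    apply: (@injective_derive _ _ _ phi x); last by rewrite phiD // !mxE.
      exact: smooth_on_differentiable Sphi Dx.
    exact: inj.
  by move=> /rowP r0; have := r0 0; have := r0 1; rewrite !mxE.
have M0 x : D x -> M x != 0 by move=> Dx; apply: cross_neq0; exact: free.
have MM0 x : D x -> dot (M x) (M x) != 0 by move=> Dx; rewrite dot_eq0 M0.
have zD y : E' y -> differentiable z y /\ forall v, 'D_v P y = 'D_('D_v z y) phi (z y).
  move=> E'y; apply: (lift_differentiable lp oE' E'y _ zP).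
  exact: (smooth_on_differentiable SP (sE' _ E'y)).
have DzE y v : E' y ->
    ('D_v z y) 0 0 = dot (cross ('D_v P y) (b (z y))) (M (z y)) / dot (M (z y)) (M (z y)) /\
    ('D_v z y) 0 1 = dot (cross (a (z y)) ('D_v P y)) (M (z y)) / dot (M (z y)) (M (z y)).
  move=> E'y; have [Dz _ _] := zP _ E'y; have [_ ->] := zD _ E'y.
  rewrite phiD //; set s := _ 0 0; set t := _ 0 1.
  by rewrite cross_combl cross_combr -/(M (z y)) !dot_lin !mulfK ?MM0.
have E'D y : E' y -> D (z y) by case/zP.
have Sz : smooth_on E' z.
  elim=> [y /zP[]//|k Cz]; split=> [y /zD[]//|v].
  have Ccomp (f : 'rV[R]_2 -> E3 R) : smooth_on D f -> class_C k E' (fun y => f (z y)).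
    move=> Sf; apply/class_C_rowP => // i.
    exact: (class_C_comp oE' E'D Cz ((class_C_rowP k f oD).1 (Sf k) i)).
  have CP : class_C k E' ('D_v P).
    by apply: class_C_sub sE' _; exact: (smooth_on_derive v SP).
  have CMM : class_C k E' (fun y => (dot (M (z y)) (M (z y)))^-1).
    apply: class_CV => //; first by move=> y /E'D /MM0.
    by apply: class_C_dot => //; exact: Ccomp.
  apply/class_C_rowP => // i.
  have [i0|i1] : i = 0 \/ i = 1.
    by case: i => -[|[|//]] ?; [left|right]; apply/val_inj.
  - have C := class_CM oE' (class_C_dot oE' (class_C_cross oE' CP (Ccomp b Sb)) (Ccomp M SM)) CMM.
    by apply: class_C_eq C => // y /(DzE _ v) [e _]; rewrite i0 e.
  - have C := class_CM oE' (class_C_dot oE' (class_C_cross oE' (Ccomp a Sa) CP) (Ccomp M SM)) CMM.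
    by apply: class_C_eq C => // y /(DzE _ v) [_ e]; rewrite i1 e.
exists E', (fun y => M (z y)).
split; [exact: oE'|exact: E'0|exact: sE'|exact: smooth_on_comp oE' oD E'D Sz SM|].
move=> y E'y; have [Dz pz _] := zP _ E'y; have [dz PD] := zD _ E'y.
have tan v : tangent S (P y) ('D_v phi (z y)).
  rewrite -pz; apply: (tangent_derive _ oD Dz Sphi) => x Dx.
  have [_ _ _ _ /(_ D oD (@subset_refl _ _))[W _ WE]] := lp.
  suff : (S `&` W) (phi x) by case.
  by rewrite -WE; exists x.
split.
- exact: M0.
- by move=> v; rewrite PD (phiD _ _ Dz); exact: dot_comb_cross.
- move=> v v0.
  have dM : differentiable M (z y) by exact: smooth_on_differentiable SM Dz.
  rewrite (derive_comp _ dz dM) (_ : 'D_v z y = 0) ?derive0 //.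
  apply: (@injective_derive _ _ _ phi (z y)); last by rewrite -PD.
    exact: smooth_on_differentiable Sphi Dz.
  exact: inj.
- move=> w /(orthogonal_cross_comb (M0 _ Dz))[s [t ->]].
  have -> : s *: a (z y) + t *: b (z y) = 'D_(\row_j if j == 0 then s else t) phi (z y).
    by rewrite (phiD _ _ Dz) !mxE.
  exact: tan.
- move=> n on; apply: (orthogonal_frame_cross (M0 _ Dz)); exact: on (tan _).
Qed.

End Surfaces.

(** * The laws of reflection and refraction *)

Section Deflection.
Context {R : realType}.
Implicit Types (S : set (E3 R)) (u N n p : E3 R) (l : oriented_line R).

Lemma dir_dot l : dot (dir l) (dir l) = 1.
Proof. exact/enorm1/dir_unit. Qed.

Lemma on_lineE l p : on_line l p <-> p = foot l + dot p (dir l) *: dir l.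
Proof.
split=> [[t pt]|->]; last by exists (dot p (dir l)).
by rewrite {2}pt dotDl dotZl foot_orth dir_dot add0r mulr1.
Qed.

Lemma on_line_trans l p q : on_line l p -> on_line l q ->
  q + dot (p - q) (dir l) *: dir l = p.
Proof.
move=> [t ->] [s ->]; rewrite opprD addrACA subrr add0r -scalerBl dotZl dir_dot mulr1.
by rewrite -addrA -scalerDl (addrC s) subrK.
Qed.

Definition tangential u N := u - (dot u N / dot N N) *: N.

(** The direction of the deflected ray in terms of the incident direction [u], the
    quotient [r] of the indices and a normal vector [N] of any length. In the
    refracting case, [a] is the tangential part given by Snell's law, and the
    normal component is found from the unit length of the direction: the square
    root is the quotient of the normal components of the two directions,
    which is positive. *)
Definition deflected (kind : surface_kind) (r : R) u N : E3 R :=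
  match kind with
  | Reflecting => u - (2 * (dot u N / dot N N)) *: N
  | Refracting => let a := r *: tangential u N in
      a + (dot u N * Num.sqrt (dot N N * (1 - dot a a) * (dot u N ^+ 2)^-1) / dot N N) *: N
  end.

Definition deflects S kind (nu nu' : R) p l l' : Prop :=
  match kind with
  | Reflecting => reflected S p l l'
  | Refracting => refracted nu nu' S p l l'
  end.

Lemma deflects_on_line S kind nu nu' p l l' : deflects S kind nu nu' p l l' -> on_line l' p.
Proof. by case: kind => -[]. Qed.

(** The laws leave the unit normal vector unspecified; as it is proportional to
    [N], they can be rewritten in terms of [N] alone. The second and last
    conclusions are what the differential arguments use: the deflected ray is
    transverse too, and [nu' u' - nu u] is normal to the surface. *)
Lemma deflected_law S kind (nu nu' : R) p N l l' :
  0 < nu -> 0 < nu' -> (kind = Reflecting -> nu' = nu) -> N != 0 ->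
  (forall w, dot w N = 0 -> tangent S p w) ->
  (forall n, orthogonal_to S p n -> exists mu, n = mu *: N) ->
  transverse S p l ->
  deflects S kind nu nu' p l l' ->
  let a := (nu / nu') *: tangential (dir l) N in
  [/\ dot (dir l) N != 0, dot (dir l') N != 0,
      kind = Refracting -> 0 < dot N N * (1 - dot a a) * (dot (dir l) N ^+ 2)^-1,
      dir l' = deflected kind (nu / nu') (dir l) N &
      exists s, nu' *: dir l' - nu *: dir l = s *: N].
Proof.
move=> nu0 nu'0 nuE N0 tanN orthN trans law a.
have NN0 : dot N N != 0 by rewrite dot_eq0.
have uN0 : dot (dir l) N != 0 by apply/eqP => /tanN.
have proj n w : unit_normal S p n -> dot w n *: n = (dot w N / dot N N) *: N.
  move=> [/enorm1 n1 /orthN[mu nE]]; move: n1; rewrite nE !dot_lin => mu1; rewrite scalerA.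
  congr (_ *: _); apply: (mulIf NN0); rewrite divfK //.
  by transitivity (dot w N * (mu * (mu * dot N N))); [ring|rewrite mu1 mulr1].
case: kind nuE law => [/(_ erefl) nuE [_ [n un dE]]|_ [_ _ [n [un snell sgE]]]].
  have dE' : dir l' = deflected Reflecting (nu / nu') (dir l) N.
    by rewrite dE -scalerA (proj _ _ un) scalerA.
  split=> //.
    rewrite dE' /= !dot_lin -mulrA divfK //.
    by rewrite (_ : _ - _ = - dot (dir l) N) ?oppr_eq0 //; ring.
  exists (- nu * (2 * (dot (dir l) N / dot N N))).
  by rewrite dE' nuE /= scalerBr addrAC subrr add0r scalerA mulNr scaleNr.
have dE : dir l' = a + (dot (dir l') N / dot N N) *: N.
  rewrite /a /tangential -!(proj _ _ un) -[LHS](subrK (dot (dir l') n *: n)).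
  congr (_ + _); apply: (scalerI (lt0r_neq0 nu'0)).
  by rewrite snell scalerA mulrCA divff ?mulr1 // gt_eqF.
have aN : dot a N = 0 by rewrite /a !dot_lin divfK // subrr mulr0.
have aE : a = (nu / nu') *: tangential (dir l) N by [].
clearbody a.
have bE : dot N N * (1 - dot a a) = dot (dir l') N ^+ 2.
  have := dir_dot l'; rewrite {1 2}dE !dot_lin aN (dotC N a) aN => <-.
  by move: NN0; move: (dot N N) (dot a a) (dot _ _) => x y z x0; field.
have bc0 : 0 < dot (dir l') N / dot (dir l) N.
  have [_ /orthN[mu nE]] := un.
  have mu0 : mu != 0.
    apply/eqP => mu0; have [/enorm1 + _] := un; rewrite nE mu0 scale0r dot0l => /eqP.
    by rewrite eq_sym oner_eq0.
  move: sgE; rewrite nE !dotZr !sgrM => /mulfI sgE.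
  have {}sgE : Num.sg (dot (dir l') N) = Num.sg (dot (dir l) N) by apply: sgE; rewrite sgr_eq0.
  have bc : 0 < dot (dir l') N * dot (dir l) N.
    by rewrite -sgr_cp0 sgrM sgE -expr2 sqr_sg uN0.
  rewrite (_ : _ / _ = (dot (dir l') N * dot (dir l) N) / dot (dir l) N ^+ 2); last by field.
  by rewrite divr_gt0 // exprn_even_gt0.
have b0 : dot (dir l') N != 0.
  by apply/eqP => b0; move: bc0; rewrite b0 mul0r ltxx.
have sqE : dot N N * (1 - dot a a) * (dot (dir l) N ^+ 2)^-1 =
    (dot (dir l') N / dot (dir l) N) ^+ 2 by rewrite bE expr_div_n.
split=> //.
- by move=> _; rewrite sqE exprn_gt0.
- rewrite {1}dE /= -aE sqE sqrtr_sqr gtr0_norm //.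
  by rewrite mulrCA divff // mulr1.
- exists (nu' * (dot (dir l') N / dot N N) - nu * (dot (dir l) N / dot N N)).
  rewrite {1}dE scalerDr scalerA scalerBl -addrA; rewrite aE /tangential scalerA mulrCA divff ?gt_eqF // mulr1.
  by rewrite scalerBr !scalerA; apply/rowP => i; rewrite !mxE; ring.
Qed.

Lemma smooth_on_deflected (V : normedModType R) (E : set V) kind r (u N : V -> E3 R) :
  open E -> smooth_on E u -> smooth_on E N ->
  (forall y, E y -> N y != 0) -> (forall y, E y -> dot (u y) (N y) != 0) ->
  (kind = Refracting -> forall y, E y -> let a := r *: tangential (u y) (N y) in
    0 < dot (N y) (N y) * (1 - dot a a) * (dot (u y) (N y) ^+ 2)^-1) ->
  smooth_on E (fun y => deflected kind r (u y) (N y)).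
Proof.
move=> oE Su SN N0 uN0 pos.
have SNN : smooth_on E (fun y => (dot (N y) (N y))^-1).
  by apply: smooth_onV (smooth_on_dot oE SN SN) => // y Ey; rewrite dot_eq0 N0.
have SuN : smooth_on E (fun y => dot (u y) (N y)) by exact: smooth_on_dot.
have Sk := smooth_onM oE SuN SNN.
case: kind pos => [_|/(_ erefl) pos].
  apply: (smooth_onB oE Su); apply: (smooth_onZ oE _ SN).
  exact: smooth_onM oE (smooth_on_cst _ _) Sk.
have Sa : smooth_on E (fun y => r *: tangential (u y) (N y)).
  apply: (smooth_onZ oE (smooth_on_cst _ _)).
  exact: smooth_onB oE Su (smooth_onZ oE Sk SN).
apply: (smooth_onD oE Sa); apply: (smooth_onZ oE _ SN).
apply: (smooth_onM oE _ SNN); apply: (smooth_onM oE SuN).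
apply: (smooth_on_sqrt oE pos); apply: (smooth_onM oE); last first.
  apply: (smooth_onV oE); first by move=> y /uN0; rewrite expf_eq0.
  exact: (smooth_onM oE SuN SuN).
apply: (smooth_onM oE (smooth_on_dot oE SN SN)).
exact: smooth_onB oE (smooth_on_cst _ _) (smooth_on_dot oE Sa Sa).
Qed.

Lemma derive_unit (V : normedModType R) (E : set V) (u : V -> E3 R) y v :
  open E -> E y -> differentiable u y -> (forall y, E y -> dot (u y) (u y) = 1) ->
  dot (u y) ('D_v u y) = 0.
Proof.
move=> oE Ey du u1.
have : 'D_v (fun y => dot (u y) (u y)) y = 0.
  rewrite -[RHS](derive_cst (1 : R) y v); apply: near_eq_derive.
  exact: near_open oE Ey u1.
rewrite derive_dot // (dotC ('D_v _ _)) => e.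
by move: e; move: (dot _ _) => x ?; lra.
Qed.

End Deflection.

(** * Deflected families of rays *)

Section LocalFamilies.
Context {R : realType} {V : normedModType R}.
Implicit Types (E : set V) (l : V -> oriented_line R) (P Q : V -> E3 R).

Definition smooth_rays E l :=
  smooth_on E (fun y => dir (l y)) /\ smooth_on E (fun y => foot (l y)).

(** A wavefront of the family, which may have singular points: [Q] is
    not assumed to be an immersion. *)
Definition normal_section E l Q :=
  smooth_on E Q /\
  forall y, E y -> on_line (l y) (Q y) /\ forall v, dot (dir (l y)) ('D_v Q y) = 0.

Lemma derive_dir E l y v : open E -> E y -> smooth_rays E l ->
  dot (dir (l y)) ('D_v (fun y => dir (l y)) y) = 0.
Proof.
move=> oE Ey [Su _]; apply: (derive_unit _ oE Ey (smooth_on_differentiable Su Ey)) => z _.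
exact: dir_dot.
Qed.

Lemma foot_derive0 E l P y v : open E -> E y -> smooth_on E P ->
  smooth_rays E l -> (forall y, E y -> on_line (l y) (P y)) ->
  'D_v P y = 0 -> 'D_v (fun y => dir (l y)) y = 0 -> 'D_v (fun y => foot (l y)) y = 0.
Proof.
move=> oE Ey SP [Su _] on P0 u0.
have dP := smooth_on_differentiable SP Ey; have du := smooth_on_differentiable Su Ey.
have dPu : differentiable (fun y => dot (P y) (dir (l y))) y by exact: differentiable_dot.
transitivity ('D_v (fun y => P y - dot (P y) (dir (l y)) *: dir (l y)) y).
  apply: near_eq_derive; apply: (near_open oE Ey) => z /on /on_lineE e.
  by rewrite {1}e addrK.
have dS : differentiable (fun y => dot (P y) (dir (l y)) *: dir (l y)) y.
  by apply: smooth_on_differentiable Ey; apply: smooth_onZ => //; exact: smooth_on_dot.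
rewrite deriveB; [|exact: diff_derivable..].
by rewrite derive_scale // derive_dot // P0 u0 dot0l dot0r addr0 scale0r scaler0 addr0 subrr.
Qed.

(** The vector [nu' u' - nu u] is normal to the surface, hence orthogonal to the
    velocities of [P]. The implication in the conclusion says that the incident
    ray cannot move while the deflected one is at rest. Indeed, [P] can then
    only move along the deflected ray, which is transverse to the surface; so
    [P] is at rest, and the normal vector as well. Hence the derivative of
    [nu' u' - nu u], which is that of [- nu u], is normal to the surface; being
    orthogonal to the unit vector [u], which is transverse, it vanishes. *)
Lemma deflected_family S kind (nu nu' : R) E l l' P y0 :
  smooth_surface S -> 0 < nu -> 0 < nu' -> (kind = Reflecting -> nu' = nu) ->
  open E -> E y0 -> smooth_on E P -> smooth_rays E l ->
  (forall y, E y -> [/\ S (P y), on_line (l y) (P y), transverse S (P y) (l y) &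
     deflects S kind nu nu' (P y) (l y) (l' y)]) ->
  exists E', [/\ open E', E' y0, E' `<=` E, smooth_rays E' l' &
    forall y v, E' y ->
      dot ('D_v P y) (nu' *: dir (l' y) - nu *: dir (l y)) = 0 /\
      ('D_v (fun y => dir (l' y)) y = 0 -> 'D_v (fun y => foot (l' y)) y = 0 ->
       'D_v (fun y => dir (l y)) y = 0 /\ 'D_v (fun y => foot (l y)) y = 0)].
Proof.
move=> smS nu0 nu'0 nuE oE Ey0 SP Sl law.
have [|E' [N [oE' E'y0 sE' SN NP]]] := smooth_normal_along smS oE Ey0 SP.
  by move=> y /law[].
have lawN y : E' y -> _ := fun E'y =>
  let: And5 N0 _ _ tanN orthN := NP y E'y in
  let: And4 _ _ trans lw := law y (sE' y E'y) in
  deflected_law nu0 nu'0 nuE N0 tanN orthN trans lw.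
have SP' : smooth_on E' P by exact: smooth_on_sub SP.
have Sl' : smooth_rays E' l.
  by case: Sl => Su Sq; split; [exact: smooth_on_sub Su|exact: smooth_on_sub Sq].
have [Su Sq] := Sl'.
have on y : E' y -> on_line (l y) (P y) by move=> /sE'/law[].
have on' y : E' y -> on_line (l' y) (P y).
  by move=> /sE'/law[_ _ _] /deflects_on_line.
have Su' : smooth_on E' (fun y => dir (l' y)).
  apply: (@smooth_on_eq _ _ _ _ (fun y => deflected kind (nu / nu') (dir (l y)) (N y))) => //.
    by move=> y /lawN[].
  apply: smooth_on_deflected => //.
  - by move=> y /NP[].
  - by move=> y /lawN[].
  - by move=> k y /lawN[_ _ /(_ k)].
have Sq' : smooth_on E' (fun y => foot (l' y)).
  apply: (@smooth_on_eq _ _ _ _ (fun y => P y - dot (P y) (dir (l' y)) *: dir (l' y))) => //.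
    by move=> y /on' /on_lineE e; rewrite {1}e addrK.
  apply: smooth_onB => //; apply: smooth_onZ => //; exact: smooth_on_dot.
exists E'; split=> // y v E'y.
have [N0 PN PN0 _ _] := NP y E'y.
have [uN0 u'N0 _ _ [s sE]] := lawN y E'y.
split; first by rewrite sE dotZr PN mulr0.
move=> du'0 dq'0.
have dP := smooth_on_differentiable SP' E'y.
have du := smooth_on_differentiable Su E'y.
have du' := smooth_on_differentiable Su' E'y.
have dq' := smooth_on_differentiable Sq' E'y.
have dN := smooth_on_differentiable SN E'y.
have P0 : 'D_v P y = 0.
  have dPu : differentiable (fun y => dot (P y) (dir (l' y))) y by exact: differentiable_dot.
  have PE : 'D_v P y = 'D_v (fun y => dot (P y) (dir (l' y))) y *: dir (l' y).
    transitivity ('D_v (fun y => foot (l' y) + dot (P y) (dir (l' y)) *: dir (l' y)) y).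
      by apply: near_eq_derive; apply: (near_open oE' E'y) => z /on' /on_lineE.
    have dS : differentiable (fun y => dot (P y) (dir (l' y)) *: dir (l' y)) y.
      by apply: smooth_on_differentiable E'y; apply: smooth_onZ => //; exact: smooth_on_dot.
    rewrite deriveD; [|exact: diff_derivable..].
    by rewrite derive_scale // dq'0 du'0 scaler0 addr0 add0r.
  have := PN v; rewrite PE dotZl => /eqP; rewrite mulf_eq0 (negPf u'N0) orbF => /eqP ->.
  by rewrite scale0r.
have dN0 := PN0 v P0.
suff u0 : 'D_v (fun y => dir (l y)) y = 0 by split=> //; exact: foot_derive0 oE' E'y SP' Sl' on P0 u0.
pose G z := nu' *: dir (l' z) - nu *: dir (l z).
pose c z := dot (G z) (N z) * (dot (N z) (N z))^-1.
have SG : smooth_on E' G.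
  by apply: smooth_onB => //; apply: smooth_onZ => //; exact: smooth_on_cst.
have Sc : smooth_on E' c.
  apply: smooth_onM => //; first exact: smooth_on_dot.
  by apply: smooth_onV => //; [move=> z /NP[+ _ _ _ _]; rewrite dot_eq0|exact: smooth_on_dot].
have GE z : E' z -> G z = c z *: N z.
  move=> E'z; have [_ _ _ _ [t tE]] := lawN z E'z; have [Nz0 _ _ _ _] := NP z E'z.
  by rewrite /c /G tE dotZl mulfK // dot_eq0.
have DG : 'D_v G y = - nu *: 'D_v (fun y => dir (l y)) y.
  rewrite deriveB; [|exact/diff_derivable/differentiableZ..].
  rewrite deriveZ; last exact: diff_derivable.
  rewrite deriveZ; last exact: diff_derivable.
  by rewrite du'0 scaler0 sub0r scaleNr.
have DG' : 'D_v G y = 'D_v c y *: N y.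
  transitivity ('D_v (fun z => c z *: N z) y).
    by apply: near_eq_derive; exact: near_open oE' E'y GE.
  rewrite derive_scale //; last exact: smooth_on_differentiable Sc E'y.
  by rewrite dN0 scaler0 addr0.
have c0 : 'D_v c y = 0.
  have := congr1 (dot (dir (l y))) DG; rewrite DG' !dotZr (derive_dir v oE' E'y Sl') mulr0.
  by move/eqP; rewrite mulf_eq0 (negPf uN0) orbF => /eqP.
apply/eqP; move: DG; rewrite DG' c0 scale0r => /esym/eqP.
by rewrite scaler_eq0 oppr_eq0 gt_eqF.
Qed.

(** The point [Q' = P + s u'] of the deflected ray is chosen so that the optical
    length [nu (P - Q).u + nu' s] from [Q] to [Q'] is zero; differentiating this
    relation, with [u.dQ = 0] and [dP] orthogonal to [nu' u' - nu u], gives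
    [u'.dQ' = 0]. *)
Lemma normal_section_deflected (nu nu' : R) E l l' P Q : 0 < nu' -> open E ->
  smooth_on E P -> smooth_rays E l -> smooth_rays E l' ->
  (forall y, E y -> on_line (l y) (P y)) -> (forall y, E y -> on_line (l' y) (P y)) ->
  (forall y v, E y -> dot ('D_v P y) (nu' *: dir (l' y) - nu *: dir (l y)) = 0) ->
  normal_section E l Q -> exists Q', normal_section E l' Q'.
Proof.
move=> nu'0 oE SP Sl Sl' on on' PG [SQ lQ].
have [Su _] := Sl; have [Su' _] := Sl'.
pose s y := - (nu / nu') * dot (P y - Q y) (dir (l y)).
have Ss : smooth_on E s.
  apply: (smooth_onM oE (smooth_on_cst _ _)).
  by apply: smooth_on_dot => //; exact: smooth_onB.
exists (fun y => P y + s y *: dir (l' y)); split.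
  by apply: smooth_onD => //; exact: smooth_onZ.
move=> y Ey; split.
  have [t ->] := on' y Ey; exists (t + s y); by rewrite scalerDl addrA.
move=> v.
have dP := smooth_on_differentiable SP Ey; have dQ := smooth_on_differentiable SQ Ey.
have du := smooth_on_differentiable Su Ey; have du' := smooth_on_differentiable Su' Ey.
have ds := smooth_on_differentiable Ss Ey.
have dPQ : differentiable (fun y => P y - Q y) y by exact: differentiableB.
have dPQu : differentiable (fun y => dot (P y - Q y) (dir (l y))) y by exact: differentiable_dot.
have dsu : differentiable (fun y => s y *: dir (l' y)) y.
  by apply: smooth_on_differentiable Ey; exact: smooth_onZ.
have [[t tE] Qu] := lQ y Ey.
have Ds : 'D_v s y = - (nu / nu') * dot ('D_v P y) (dir (l y)).
  transitivity (- (nu / nu') *: 'D_v (fun y => dot (P y - Q y) (dir (l y))) y : R).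
    by rewrite -deriveZ //; exact: diff_derivable.
  rewrite scalerE; congr (_ * _).
  rewrite derive_dot //.
  have -> : dot (P y - Q y) ('D_v (fun y => dir (l y)) y) = 0.
    have [t' ->] := on y Ey; rewrite tE opprD addrACA subrr add0r -scalerBl dotZl.
    by rewrite (derive_dir v oE Ey Sl) mulr0.
  rewrite addr0 deriveB; [|exact: diff_derivable..].
  by rewrite dotDl dotNl (dotC ('D_v Q y)) Qu subr0.
rewrite deriveD; [|exact: diff_derivable..].
rewrite derive_scale // !dotDr !dotZr dir_dot (derive_dir v oE Ey Sl') mulr0 addr0 mulr1 Ds.
have := PG y v Ey; rewrite dotDr dotNr !dotZr => /eqP; rewrite subr_eq0 => /eqP PGE.
rewrite mulNr mulrAC -PGE dotC mulrAC divff ?gt_eqF //.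
by rewrite mul1r subrr.
Qed.

End LocalFamilies.

(** * Families of rays in a chart *)

Section Pairs.
Context {R : realType} {V W W' : normedModType R}.

Lemma smooth_on_pairP (E : set V) (f : V -> W) (g : V -> W') : open E ->
  smooth_on E (fun y => (f y, g y)) <-> smooth_on E f /\ smooth_on E g.
Proof.
move=> oE; split=> [Sfg|[Sf Sg]]; last exact: smooth_on_pair.
split.
  refine (@smooth_on_linear R V _ _ E (fst : {linear (W * W')%type -> W}) _ oE _ Sfg) => p.
  exact: cvg_fst.
refine (@smooth_on_linear R V _ _ E (snd : {linear (W * W')%type -> W'}) _ oE _ Sfg) => p.
exact: cvg_snd.
Qed.

Lemma derive_pair (f : V -> W) (g : V -> W') y v :
  differentiable f y -> differentiable g y ->
  'D_v (fun y => (f y, g y)) y = ('D_v f y, 'D_v g y).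
Proof.
move=> df dg; rewrite deriveE; last exact: differentiable_pair.
by rewrite diff_pair // !deriveE.
Qed.

End Pairs.

Section Charts.
Context {R : realType} {F : smooth_manifold R 2}.
Implicit Types (c : chart R F 2) (L : F -> oriented_line R).

Lemma chart_inv_open c (U : set F) : open U ->
  open ((chart_map c @` chart_dom c) `&` chart_inv c @^-1` U).
Proof.
move=> oU; have oA := @chart_img_open _ _ _ c.
have := @chart_inv_continuous _ _ _ c; rewrite continuous_open_subspace //.
by move=> /(continuous_inP _ oA); apply.
Qed.

Lemma chart_map_open c (D : set 'rV[R]_2) : open D ->
  open (chart_dom c `&` chart_map c @^-1` D).
Proof.
move=> oD; have oA := @chart_dom_open _ _ _ c.
have := @chart_map_continuous _ _ _ c; rewrite continuous_open_subspace //.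
by move=> /(continuous_inP _ oA); apply.
Qed.

Lemma chart_invK c y : (chart_map c @` chart_dom c) y -> chart_map c (chart_inv c y) = y.
Proof. by case=> k dk <-; rewrite chart_mapK. Qed.

Lemma smooth_rays_chart L c k : (forall k, smooth_map_at (@line_coord R \o L) k) ->
  atlas c -> chart_dom c k ->
  exists E, [/\ open E, E (chart_map c k) & smooth_rays E (L \o chart_inv c)].
Proof.
move=> SL ac ck; have [E [oE Ek SE]] := SL k c ac ck.
by exists E; split=> //; apply/(smooth_on_pairP _ _ oE).
Qed.

Definition has_normal_section L c k :=
  exists E Q, [/\ open E, E (chart_map c k), smooth_rays E (L \o chart_inv c) &
    normal_section E (L \o chart_inv c) Q].

(** A surface orthogonal to the rays is transverse to them, so regularity makes
    the point where a ray crosses it a smooth function of the ray. *)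
Lemma rectangular_normal_section L c k m :
  (forall k, smooth_map_at (@line_coord R \o L) k) -> rectangular L ->
  regular_point L k m -> atlas c -> chart_dom c k -> has_normal_section L c k.
Proof.
move=> SL rect reg ac ck.
have [S [smS Sm [U1 [oU1 U1k cross]]]] := rect k m reg.
have [mk regS] := reg.
have orth := (cross k U1k).2 m Sm mk.
have trans : transverse S m (L k).
  by move=> /orth; rewrite dir_dot => /eqP; rewrite oner_eq0.
have [U [B [f [[oU Uk] [[W oW BE] Bm] fP [g [_ _ Sf _]]]]]] := regS S smS Sm trans.
have [E1 [oE1 E1k SE1]] := smooth_rays_chart SL ac ck.
have [E2 [oE2 E2k SE2]] := Sf k Uk c ac ck.
pose E3 := (chart_map c @` chart_dom c) `&` chart_inv c @^-1` (U `&` U1).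
have oE3 : open E3 by apply: chart_inv_open; exact: openI.
have E3k : E3 (chart_map c k) by split; [exists k|rewrite /= chart_mapK].
have oE : open (E1 `&` E2 `&` E3) by apply: openI => //; exact: openI.
exists (E1 `&` E2 `&` E3), (f \o chart_inv c); split=> //.
  by case: SE1 => Su Sq; split; apply: smooth_on_sub Su || apply: smooth_on_sub Sq;
    move=> y [[]].
have SQ : smooth_on (E1 `&` E2 `&` E3) (f \o chart_inv c).
  by apply: smooth_on_sub SE2 => y [[]].
split=> // y Ey; have [_ [_ [/= Uy U1y]]] := Ey.
have SB k' : U k' -> S (f k') /\ on_line (L k') (f k').
  by move=> Uk'; have [+ onk] := (fP k' Uk' (f k')).2 erefl; rewrite BE => -[].
have [Sy ony] := SB _ Uy; split=> //= v.
apply: ((cross _ U1y).2 _ Sy ony).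
apply: (tangent_derive _ oE Ey SQ) => z [_ [_ [/= Uz _]]].
by have [] := SB _ Uz.
Qed.

Lemma derive_coord_cst (V : normedModType R) n (f : V -> 'rV[R]_n) x v i (a : R) :
  differentiable f x -> (\forall y \near x, f y 0 i = a) -> ('D_v f x) 0 i = 0.
Proof.
move=> df fa; rewrite derive_row // -[RHS](derive_cst a x v).
exact: near_eq_derive.
Qed.

(** Let a coordinate plane through [m] be transverse to the ray. By regularity, the
    rays are smooth functions of the points where they cross it. If [W] is
    stationary at [m] in a direction [v], then the velocity of the crossing point
    in this direction is along the ray, because the crossing point and [W] lie on
    the same ray and coincide at [m]. As it is also tangent to the plane, it is
    zero; so the ray is stationary, and [v = 0]. *)
Lemma regular_section_immersive L c k m (E : set 'rV[R]_2) (W : 'rV[R]_2 -> E3 R) :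
  regular_point L k m -> atlas c -> chart_dom c k ->
  open E -> E (chart_map c k) -> smooth_rays E (L \o chart_inv c) -> smooth_on E W ->
  (forall y, E y -> on_line (L (chart_inv c y)) (W y)) -> W (chart_map c k) = m ->
  injective ('d W (chart_map c k)).
Proof.
set y0 := chart_map c k; move=> [mk reg] ac ck oE Ey0 [Su Sq] SW onW Wm.
have inv0 : chart_inv c y0 = k by rewrite /y0 chart_mapK.
have [i ui0] : exists i, dir (L k) 0 i != 0.
  apply/existsP; rewrite -negb_forall; apply/negP => /forallP u0.
  have d0 : dir (L k) = 0 by apply/rowP => i; rewrite mxE; exact/eqP.
  by have /eqP := dir_dot (L k); rewrite d0 dot0l eq_sym oner_eq0.
(* The plane spanned by the two coordinate axes other than the [i]-th. *)
pose A : 'M[R]_(2, 3) := row' i 1%:M.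
have AA : A *m A^T = 1%:M.
  apply/matrixP => j j'; rewrite !mxE (bigD1 (lift i j)) //= big1 => [|h hj].
    by rewrite !mxE eqxx mul1r addr0 (inj_eq lift_inj) eq_sym.
  by rewrite !mxE eq_sym (negPf hj) mul0r.
have Ai x : (x *m A) 0 i = 0.
  rewrite mxE big1 // => j _; rewrite !mxE (negPf (_ : lift i j != i)) ?mulr0 //.
  by rewrite eq_sym neq_lift.
pose pi x : E3 R := m + x *m A.
pose pr p : 'rV[R]_2 := (p - m) *m A^T.
have piK x : pr (pi x) = x.
  by rewrite /pr /pi addrAC subrr add0r -mulmxA AA mulmx1.
have pi0 : pi 0 = m by rewrite /pi mul0mx addr0.
have oT := @openT 'rV[R]_2.
have Spi : smooth_on setT pi.
  apply: (smooth_onD oT (smooth_on_cst _ _)); apply: (smooth_on_mulmx _ oT).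
  exact: smooth_on_id.
have [K K0 KA] := mulmx_lipschitz A^T.
have bilip x y : setT x -> setT y -> K^-1 * `|x - y| <= `|pi x - pi y|.
  move=> _ _; rewrite ler_pdivrMl //.
  have -> : x - y = (pi x - pi y) *m A^T.
    by rewrite -{1}(piK x) -{1}(piK y) /pr -mulmxBl opprB addrA subrK.
  exact: KA.
have Ki0 : 0 < K^-1 by rewrite invr_gt0.
have smS := image_smooth_surface oT Spi Ki0 bilip.
have lp := bilipschitz_parametrization oT Spi Ki0 bilip.
have Si p : (pi @` setT) p -> p 0 i = m 0 i.
  by move=> [x _ <-]; rewrite /pi mxE Ai addr0.
have Sm : (pi @` setT) m by exists 0.
have trans : transverse (pi @` setT) m (L k).
  move=> [g [[D [oD D0 Sg]] nS _ ge]]; move: ui0; rewrite -ge.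
  rewrite (@derive_coord_cst _ _ g 0 1 i (m 0 i)) ?eqxx //.
    exact: smooth_on_differentiable Sg D0.
  by apply: filterS nS => t /Si.
have [U [B [f [[oU Uk] [[Z oO BE] Bm] fP [g [fg _ Sf [_ Sgf]]]]]]] := reg _ smS Sm trans.
have fk : f k = m by apply/esym; exact/(fP k Uk m).
have fB k' : U k' -> (pi @` setT) (f k') /\ on_line (L k') (f k').
  by move=> Uk'; have [+ onk] := (fP k' Uk' (f k')).2 erefl; rewrite BE => -[].
pose ft := f \o chart_inv c.
have ft0 : ft y0 = m by rewrite /ft /= inv0.
have [D1 [oD1 D1y0 Sft]] := Sf k Uk c ac ck.
have dft : differentiable ft y0 by exact: smooth_on_differentiable Sft D1y0.
have [G1 [oG1 G1y0 SG]] : smooth_at (chart_map c \o g \o pi) 0.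
  apply: (Sgf pi setT 0 c lp) => //; rewrite pi0 //.
  by rewrite -fk (fg k Uk).2.
pose H := (chart_map c @` chart_dom c) `&` chart_inv c @^-1` U.
have oH : open H by exact: chart_inv_open.
have Hy0 : H y0 by split; [exists k|rewrite /= inv0].
apply: derive_injective; first exact: smooth_on_differentiable SW Ey0.
move=> v Wv0.
have dW := smooth_on_differentiable SW Ey0.
have du := smooth_on_differentiable Su Ey0.
pose t y := dot (ft y - W y) (dir (L (chart_inv c y))).
have dt : differentiable t y0 by exact: differentiable_dot (differentiableB dft dW) du.
have t0 : t y0 = 0 by rewrite /t ft0 Wm subrr dot0l.
have ftE : \forall y \near y0, ft y = W y + t y *: dir (L (chart_inv c y)).
  have oEH : open (E `&` H) by exact: openI.
  apply: (near_open oEH (conj Ey0 Hy0)) => y [Ey [_ /= Uy]].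
  by have [_ on] := fB _ Uy; exact/esym/(on_line_trans on (onW y Ey)).
have Dft : 'D_v ft y0 = 'D_v t y0 *: dir (L k).
  have dtu : differentiable (fun y => t y *: dir (L (chart_inv c y))) y0.
    apply/differentiable_rowP => j.
    rewrite (_ : (fun y => _) = t * (fun y => dir (L (chart_inv c y)) 0 j)).
      by apply: differentiableM => //; move: j; apply/differentiable_rowP.
    by apply/funext => y; rewrite mxE.
  rewrite (near_eq_derive v ftE) deriveD; [|exact: diff_derivable..].
  by rewrite Wv0 add0r derive_scale // t0 scale0r addr0 /= inv0.
have ft_i : ('D_v ft y0) 0 i = 0.
  apply: (@derive_coord_cst _ _ ft y0 v i (m 0 i) dft).
  by apply: (near_open oH Hy0) => y [_ /= Uy]; apply: Si; case: (fB _ Uy).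
have Dft0 : 'D_v ft y0 = 0.
  move: ft_i; rewrite Dft mxE => /eqP; rewrite mulf_eq0 (negPf ui0) orbF => /eqP ->.
  by rewrite scale0r.
have dfm : differentiable (fun y => ft y - m) y0 by exact: differentiableB.
have dpr : differentiable (fun y => pr (ft y)) y0 by exact: differentiable_mulmx.
have Dpr : 'D_v (fun y => pr (ft y)) y0 = 0.
  rewrite derive_mulmx // deriveB; [|exact: diff_derivable..].
  by rewrite derive_cst subr0 Dft0 mul0mx.
have pr0 : pr (ft y0) = 0 by rewrite ft0 /pr subrr mul0mx.
have dG : differentiable (chart_map c \o g \o pi) (pr (ft y0)).
  by rewrite pr0; exact: smooth_on_differentiable SG G1y0.
have : 'D_v ((chart_map c \o g \o pi) \o (fun y => pr (ft y))) y0 = 'D_v id y0.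
  apply: near_eq_derive; apply: (near_open oH Hy0) => y [Ay /= Uy].
  have [[x _ ex] _] := fB _ Uy.
  rewrite /= /ft /= -ex piK ex (fg _ Uy).2.
  exact: chart_invK.
by rewrite (derive_comp _ dpr dG) Dpr derive0 derive_id => <-.
Qed.

Lemma tangent_sub (S S' : set (E3 R)) p v : S `<=` S' -> tangent S p v -> tangent S' p v.
Proof.
move=> sS [g [Sg nS g0 ge]]; exists g; split=> //.
by apply: filterS nS => t /sS.
Qed.

(** Regularity is used twice: it makes the section [W] through [m] an immersion,
    hence the parametrization of a surface; then, applied to this surface, it
    ensures that a ray close to the given one meets it only at its own point of
    [W], where they are orthogonal. *)
Lemma normal_section_rectangular L :
  (forall k, exists c, [/\ atlas c, chart_dom c k & has_normal_section L c k]) ->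
  rectangular L.
Proof.
move=> sec k m reg; have [c [ac ck [E [Q [oE Ek Sl [SQ lQ]]]]]] := sec k.
have [mk regS] := reg.
set y0 := chart_map c k in Ek.
have inv0 : chart_inv c y0 = k by rewrite /y0 chart_mapK.
have [Su _] := Sl.
pose s := dot (m - Q y0) (dir (L k)).
pose W y := Q y + s *: dir (L (chart_inv c y)).
have Wm : W y0 = m.
  by have [on _] := lQ y0 Ek; rewrite /W inv0; apply: on_line_trans => //; rewrite -inv0.
have SW : smooth_on E W by apply: smooth_onD => //; apply: smooth_onZ => //; exact: smooth_on_cst.
have onW y : E y -> on_line (L (chart_inv c y)) (W y).
  by move=> /lQ[[t e] _]; exists (t + s); rewrite /W e scalerDl addrA.
have DW y v : E y -> dot (dir (L (chart_inv c y))) ('D_v W y) = 0.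
  move=> Ey; have [_ Qu] := lQ y Ey.
  have dQ := smooth_on_differentiable SQ Ey; have du := smooth_on_differentiable Su Ey.
  rewrite deriveD; [|exact: diff_derivable|exact/diff_derivable/differentiableZ].
  rewrite deriveZ; last exact: diff_derivable.
  by rewrite dotDr dotZr Qu (derive_dir v oE Ey Sl) mulr0 addr0.
have inj := regular_section_immersive reg ac ck oE Ek Sl SW onW Wm.
have [a [D [a0 oD Dy0 sD bilip]]] := immersion_bilipschitz oE Ek SW inj.
have SWD : smooth_on D W by exact: smooth_on_sub SW.
have smS := image_smooth_surface oD SWD a0 bilip.
have lp := bilipschitz_parametrization oD SWD a0 bilip.
have orth y : D y -> orthogonal_to (W @` D) (W y) (dir (L (chart_inv c y))).
  move=> Dy v /(tangent_parametrization lp Dy)[w ->]; exact/DW/sD.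
have Sm : (W @` D) m by exists y0.
have trans : transverse (W @` D) m (L k).
  move=> tan; have := orth y0 Dy0; rewrite Wm inv0 => /(_ _ tan).
  by rewrite dir_dot => /eqP; rewrite oner_eq0.
have [U [B [f [[oU Uk] [roB Bm] fP _]]]] := regS _ smS Sm trans.
have [Z oO BE] := roB.
exists B; split=> //; first exact: rel_open_smooth_surface roB.
pose D3 := D `&` W @^-1` Z.
have oD3 : open D3.
  by apply: (open_preimage oD oO) => y Dy; exact: smooth_on_continuous SWD Dy.
exists (U `&` (chart_dom c `&` chart_map c @^-1` D3)); split.
- by apply: openI => //; exact: chart_map_open.
- split=> //; split=> //; split=> //=; rewrite Wm.
  by move: Bm; rewrite BE => -[].
move=> k' [Uk' [ck' [Dk' Ok']]].
have inv' : chart_inv c (chart_map c k') = k' by rewrite chart_mapK.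
have BW : B (W (chart_map c k')) by rewrite BE; split=> //; exists (chart_map c k').
have lW : on_line (L k') (W (chart_map c k')).
  by have := onW _ (sD _ Dk'); rewrite inv'.
split; first by exists (W (chart_map c k')).
move=> p Bp lp'.
have -> : p = W (chart_map c k') by rewrite ((fP k' Uk' p).1 _) // ((fP k' Uk' (W (chart_map c k'))).1 _).
move=> v tan; have := orth _ Dk'; rewrite inv'; apply.
by apply: tangent_sub tan; rewrite BE => ? [].
Qed.

Lemma emerging_normal_section S kind (nu nu' : R) P L L' :
  smooth_surface S -> 0 < nu -> 0 < nu' -> (kind = Reflecting -> nu' = nu) ->
  emerging_family S kind nu nu' P L L' ->
  two_parameter_family L ->
  (forall k c, atlas c -> chart_dom c k -> has_normal_section L c k) ->
  two_parameter_family L' /\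
  (forall k c, atlas c -> chart_dom c k -> has_normal_section L' c k).
Proof.
move=> smS nu0 nu'0 nuE [SP law] [_ imm] sec.
have on k : on_line (L k) (P k) by case: (law k).
have on' k : on_line (L' k) (P k) by have [_ _ _ /deflects_on_line] := law k.
have local k c : atlas c -> chart_dom c k -> exists E Q,
    [/\ open E, E (chart_map c k), smooth_rays E (L \o chart_inv c),
        smooth_rays E (L' \o chart_inv c) &
        normal_section E (L' \o chart_inv c) Q /\
        forall y v, E y ->
          'D_v (fun y => dir (L' (chart_inv c y))) y = 0 ->
          'D_v (fun y => foot (L' (chart_inv c y))) y = 0 ->
          'D_v (fun y => dir (L (chart_inv c y))) y = 0 /\
          'D_v (fun y => foot (L (chart_inv c y))) y = 0].
  move=> ac ck; have [E1 [Q [oE1 E1k Sl [SQ lQ]]]] := sec k c ac ck.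
  have [E2 [oE2 E2k SPc]] := SP k c ac ck.
  have oE : open (E1 `&` E2) by exact: openI.
  have SPE : smooth_on (E1 `&` E2) (P \o chart_inv c) by apply: smooth_on_sub SPc => ? [].
  have sub T : T `<=` E1 -> smooth_rays T (L \o chart_inv c).
    by move=> sT; case: Sl => Su Sq; split; [exact: smooth_on_sub Su|exact: smooth_on_sub Sq].
  have [E [oE' E'k sE Sl' lawE]] := @deflected_family _ _ S kind nu nu' _
    (L \o chart_inv c) (L' \o chart_inv c) (P \o chart_inv c) (chart_map c k)
    smS nu0 nu'0 nuE oE (conj E1k E2k) SPE (sub _ (@subIsetl _ _ _))
    (fun y _ => law (chart_inv c y)).
  have SlE : smooth_rays E (L \o chart_inv c) by apply: sub => y /sE[].
  have [Q' nQ'] := @normal_section_deflected _ _ nu nu' E (L \o chart_inv c)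
    (L' \o chart_inv c) (P \o chart_inv c) Q nu'0 oE' (smooth_on_sub sE SPE) SlE Sl'
    (fun y _ => on _) (fun y _ => on' _)
    (fun y v Ey => (lawE y v Ey).1)
    (conj (smooth_on_sub (fun y Ey => (sE y Ey).1) SQ) (fun y Ey => lQ y (sE y Ey).1)).
  by exists E, Q'; split=> //; split=> // y v /(lawE y v)[].
split; last first.
  move=> k c ac ck; have [E [Q [oE Ek _ Sl' [nQ _]]]] := local k c ac ck.
  by exists E, Q.
split=> k c.
  move=> ac ck; have [E [Q [oE Ek _ Sl' _]]] := local k c ac ck.
  by exists E; split=> //; exact/smooth_on_pairP.
move=> ac ck; have [E [Q [oE Ek Sl Sl' [_ rec]]]] := local k c ac ck.
have Sll : smooth_on E (@line_coord R \o L \o chart_inv c) by exact/smooth_on_pairP.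
have Sll' : smooth_on E (@line_coord R \o L' \o chart_inv c) by exact/smooth_on_pairP.
have dl := smooth_on_differentiable Sll Ek.
have [[Su Sq] [Su' Sq']] := (Sl, Sl').
apply: derive_injective => [|v]; first exact: smooth_on_differentiable Sll' Ek.
rewrite derive_pair; [|exact: smooth_on_differentiable Su' Ek|exact: smooth_on_differentiable Sq' Ek].
case=> /(rec _ _ Ek) rv /rv [u0 q0].
apply: (imm k c ac ck); rewrite linear0 -deriveE // derive_pair.
- by rewrite u0 q0.
- exact: smooth_on_differentiable Su Ek.
- exact: smooth_on_differentiable Sq Ek.
Qed.

End Charts.

Theorem theorem1p4 (R : realType) (F : smooth_manifold R 2) (N : nat)
    (S : nat -> set (E3 R)) (kind : nat -> surface_kind) (nu : nat -> R)
    (P : nat -> F -> E3 R) (L : nat -> F -> oriented_line R)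
    (N_ge1 : (1 <= N)%N)
    (system : optical_system N S kind nu)
    (entering : two_parameter_family (L 0%N))
    (has_regular : forall k : F, exists m, regular_point (L 0%N) k m)
    (successive : forall j : nat, (1 <= j <= N)%N ->
       emerging_family (S j) (kind j) (nu j.-1) (nu j) (P j) (L j.-1) (L j))
    (entering_rectangular : rectangular (L 0%N)) :
  forall j : nat, (1 <= j <= N)%N ->
    two_parameter_family (L j) /\ rectangular (L j).
Proof.
have [nu_gt0 surf] := system.
have main j : (j <= N)%N -> two_parameter_family (L j) /\
    forall k c, atlas c -> chart_dom c k -> has_normal_section (L j) c k.
  elim: j => [_|j IH jN].
    split=> // k c ac ck; have [m reg] := has_regular k.
    exact: rectangular_normal_section entering.1 entering_rectangular reg ac ck.
  have [fam sec] := IH (ltnW jN).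
  have [smS nuE] := surf j.+1 jN.
  apply: emerging_normal_section (successive j.+1 jN) fam sec => //.
  - by apply: nu_gt0; exact: ltnW.
  - exact: nu_gt0.
  - by move=> kE; move: nuE; rewrite kE.
move=> j /andP[_ jN]; have [fam sec] := main j jN; split=> //.
apply: normal_section_rectangular => k; have [c ac ck] := atlas_cover k.
by exists c; split=> //; exact: sec.
Qed.
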